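(* Let $p\in[0,1]$ and let $(G_t)_{t\ge 1}$ be the preferential attachment random graph process with edge-steps with parameter $p$. For any positive $\varepsilon<1$, there exist positive constants $C_1$ and $C_2$, depending on $\varepsilon$ and $p$ only, such that $$\mathbb{P}\left(\frac{C_1}{t^{\gamma(p)(1+\varepsilon)}}\le \tau(G_t)\le \frac{C_2}{t^{\gamma(p)(1-\varepsilon)}}\right)=1-o(1),$$ where $\tau(G_t)$ is the global clustering coefficient of $G_t$ and $\gamma$ is the positive function $$\gamma(p):=2-p-\frac{3(1-p)}{2-p}.$$
   Context: The process. Fix a parameter $p\in[0,1]$. Let $G_1$ be the graph with one vertex and one loop attached to it. Let $(Z_t)_{t\ge 2}$ be i.i.d. Bernoulli random variables with parameter $p$. For each $t\ge 1$, the (multi)graph $G_{t+1}$ is obtained from $G_t$ as follows. If $Z_{t+1}=1$, a vertex-step is performed: a new vertex $v$ is added and joined by one edge to a vertex $u$ of $G_t$ chosen by the preferential attachment rule, i.e. with probability equal to the degree of $u$ in $G_t$ divided by the sum of the degrees of all vertices of $G_t$. If $Z_{t+1}=0$, an edge-step is performed: a new edge $\{u,w\}$ is added, where $u,w$ are vertices of $G_t$ chosen independently of each other, each by the preferential attachment rule. Loops (when $u=w$) and multiple edges are allowed; a loop contributes $2$ to the degree of its vertex. Global clustering coefficient. For a graph $G$, $$\tau(G):=3\times\frac{\#\text{ triangles in }G}{\#\text{ paths of length 2 in }G},$$ where triangles are counted without multiplicities (a triangle is a set of three distinct vertices, each two of which are joined by at least one edge). The notation $o(1)$ refers to $t\t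o\infty$.
   Formalization: The formal theorem assumes 0 < p < 1: for p = 1 the graph is a tree with one loop, so τ(G_t) = 0 and the positive lower bound fails; for p = 0 it is a single vertex with loops, so τ is undefined (0/0). *)

(* Defs.v *)
From HB Require Import structures.
From mathcomp Require Import all_boot all_order all_algebra.
From mathcomp Require Import all_classical all_reals all_analysis.
From mathcomp Require Import ring lra.

Set Implicit Arguments.
Unset Strict Implicit.
Unset Printing Implicit Defensive.

Import Order.TTheory GRing.Theory Num.Theory.
Import numFieldNormedType.Exports.

Local Open Scope classical_set_scope.
Local Open Scope ring_scope.

(* Finite multigraphs on the vertices 0, ..., nvert - 1. Edges are listed with
   repetition, most recent first; (u, u) is a loop. The order inside a pair
   records which endpoint was drawn first and is ignored by every graph
   statistic below. *)
Record mgraph := MGraph { nvert : nat ; edges : seq (nat * nat) }.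

Definition degree (G : mgraph) (u : nat) : nat :=
  (\sum_(e <- edges G) ((e.1 == u) + (e.2 == u)))%N.

Definition total_degree (G : mgraph) : nat :=
  (\sum_(u < nvert G) degree G u)%N.

Definition adj (G : mgraph) (u v : nat) : bool :=
  ((u, v) \in edges G) || ((v, u) \in edges G).

Definition num_triangles (G : mgraph) : nat :=
  #|[set S : {set 'I_(nvert G)} | (#|S| == 3%N) &&
      [forall u in S, forall v in S, (u != v) ==> adj G u v]]|%SET.

(* Two edges form a path of length 2 when neither is a loop and together they
   span exactly three vertices (so they share exactly one endpoint). *)
Definition is_path2 (e f : nat * nat) : bool :=
  [&& e.1 != e.2, f.1 != f.2 &
      size (undup [:: e.1; e.2; f.1; f.2]) == 3%N].

(* Paths of length 2 of the multigraph: parallel edges give distinct paths.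
   The condition i < j counts each unordered pair of edges once. *)
Definition num_paths2 (G : mgraph) : nat :=
  #|[set ij : 'I_(size (edges G)) * 'I_(size (edges G)) |
      (ij.1 < ij.2)%N &&
      is_path2 (nth (0, 0)%N (edges G) ij.1) (nth (0, 0)%N (edges G) ij.2)]|%SET.

Definition clustering {R : realType} (G : mgraph) : R :=
  3 * ((num_triangles G)%:R / (num_paths2 G)%:R).

Definition loop_graph : mgraph := MGraph 1 [:: (0, 0)%N].

Definition vertex_step (G : mgraph) (u : nat) : mgraph :=
  MGraph (nvert G).+1 ((nvert G, u) :: edges G).

Definition edge_step (G : mgraph) (u w : nat) : mgraph :=
  MGraph (nvert G) ((u, w) :: edges G).

Definition pa_prob {R : realType} (G : mgraph) (u : nat) : R :=
  (degree G u)%:R / (total_degree G)%:R.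

Section process.
Context {R : realType} {d : measure_display} {T : measurableType d}.
Variables (P : probability T R) (p : R).
Variables (Z : nat -> T -> bool) (G : nat -> T -> mgraph).

(* Z_2 = z_2, ..., Z_t = z_t and G_1 = g_1, ..., G_t = g_t *)
Definition history (t : nat) (z : nat -> bool) (g : nat -> mgraph) : set T :=
  [set x | (forall s, (2 <= s <= t)%N -> Z s x = z s) /\
           (forall s, (1 <= s <= t)%N -> G s x = g s)].

(* The values Z 0, Z 1 and G 0 are irrelevant. Conditional probabilities given
   an event are written in product form, to allow for null events. By pa_coin
   the variables Z_2, Z_3, ... are i.i.d. Bernoulli(p), each Z_{t+1} being
   independent of the evolution up to time t. The step laws are conditional on
   the whole evolution up to time t and on Z_{t+1}, and depend only on G_t. *)
Record pa_process : Prop := PAProcess {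
  pa_measurable_coin : forall t b, (2 <= t)%N ->
    measurable [set x | Z t x = b] ;
  pa_measurable_graph : forall t g, (1 <= t)%N ->
    measurable [set x | G t x = g] ;
  pa_init : forall x, G 1%N x = loop_graph ;
  pa_coin : forall t z g b, (1 <= t)%N ->
    P (history t z g `&` [set x | Z t.+1 x = b]) =
    (P (history t z g) * (bernoulli_pmf p b)%:E)%E ;
  pa_vertex_step : forall t z g u, (1 <= t)%N -> (u < nvert (g t))%N ->
    P (history t z g `&` [set x | Z t.+1 x = true]
         `&` [set x | G t.+1 x = vertex_step (g t) u]) =
    (P (history t z g `&` [set x | Z t.+1 x = true])
       * (pa_prob (g t) u)%:E)%E ;
  pa_edge_step : forall t z g u w, (1 <= t)%N ->
    (u < nvert (g t))%N -> (w < nvert (g t))%N ->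
    P (history t z g `&` [set x | Z t.+1 x = false]
         `&` [set x | G t.+1 x = edge_step (g t) u w]) =
    (P (history t z g `&` [set x | Z t.+1 x = false])
       * (pa_prob (g t) u * pa_prob (g t) w)%:E)%E
}.

End process.

Definition gamma {R : realType} (p : R) : R :=
  2 - p - 3 * (1 - p) / (2 - p).

Lemma gamma_gt0 {R : realType} (p : R) : 0 <= p <= 1 -> 0 < gamma p.
Proof.
move=> /andP[p0 p1]; have p2 : 0 < 2 - p by lra.
have -> : gamma p = (1 - p + p ^+ 2) / (2 - p).
  by rewrite /gamma; field; rewrite gt_eqF.
by apply: divr_gt0 => //; nra.
Qed.

(* Main.v *)
Require Import Defs.
From HB Require Import structures.
From mathcomp Require Import all_boot all_order all_algebra.
From mathcomp Require Import all_classical all_reals all_analysis.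
From mathcomp Require Import zify ring lra.

Import Order.TTheory GRing.Theory Num.Theory.
Import numFieldNormedType.Exports.

Local Open Scope classical_set_scope.
Local Open Scope ring_scope.

(** Let [c = 1 - p / 2]. A vertex of degree [d] in the graph [G_s], whose total
    degree is [2 s], gains [(2 - p) d / (2 s) = c d / s] half-edges on average in
    the next step. So a vertex born at time [i] has degree about [(s / i) `^ c]
    at time [s], and the two counts in the clustering coefficient follow, up to
    factors [t `^ o(1)].

    Paths. The number of paths of length two is about the sum of the squared
    degrees, [\sum_i (t / i) `^ (2 c)]; since [2 c = 2 - p > 1], it is dominated by
    the oldest vertices and of order [t `^ (2 - p)]. The upper bound is
    [few_paths2]; for the lower bound [many_paths2] it is enough to look at
    paths centred at vertex 0.

    Triangles. Edge-steps join [i] and [j] at time [s] with probability about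
    [(s / i) `^ c (s / j) `^ c / s ^ 2], which adds up to
    [t `^ (1 - p) / (i j) `^ c]. This is of order 1 when [i j = t `^ (2 a)] with
    [a = (1 - p) / (2 - p)]. Hence the first [t `^ a] vertices are almost a clique,
    giving [t `^ (3 a)] triangles ([many_triangles]); and there are not many more
    ([few_triangles]), because the probability of a triangle [i, j, k] is at
    most the power [1 / (2 c)] of the product of the bounds for its three pairs,
    that is [t `^ (3 a) / (i j k)]. The quotient has the exponent
    [3 a - (2 - p) = - gamma p].

    To make this rigorous one needs degrees close to their typical values. The
    function [rise r] of the degree, a ratio of Gamma functions of order
    [d `^ r], is a martingale up to a deterministic factor [s `^ (c r)]. Large
    positive [r] shows that with high probability no vertex at any time exceeds
    its typical degree by a factor [t `^ k] ([Ex_has_heavy]), and [r = - 1 / 2] that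
    a given vertex is unlikely to fall short of it ([Ex_light]). Everything else
    is a supermartingale argument conditional on these bounds: a product of three
    pair potentials for the triangles ([step_pot3]), and exponential decay for the
    probability that two vertices of large degree are not joined, or that vertex
    0 receives few new neighbours ([Ex_nonadj], [Ex_few_spokes]).

    All this takes place in the Markov chain of graphs, described by its one-step
    expectation operator [step]; [Ex_le_prob] transfers the result to any process
    with the given conditional laws. *)

Set Implicit Arguments.
Unset Strict Implicit.
Unset Printing Implicit Defensive.

(** * Well-formed graphs *)

(** Invariants of the process. Time is read off the graph, as [G_t] has [t]
    edges; so [wf_nvert_le] says that vertex [i] is not born before time
    [i.+1]. *)
Record wf_graph (G : mgraph) : Prop := WfGraph {
  wf_ends : forall e, e \in edges G -> (e.1 < nvert G)%N && (e.2 < nvert G)%N ;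
  wf_nvert_gt0 : (0 < nvert G)%N ;
  wf_nvert_le : (nvert G <= size (edges G))%N ;
  wf_degree_gt0 : forall i, (i < nvert G)%N -> (0 < degree G i)%N
}.

Lemma degree_vertex_step G u i :
  degree (vertex_step G u) i = ((nvert G == i) + (u == i) + degree G i)%N.
Proof. by rewrite /degree /= big_cons. Qed.

Lemma degree_edge_step G u w i :
  degree (edge_step G u w) i = ((u == i) + (w == i) + degree G i)%N.
Proof. by rewrite /degree /= big_cons. Qed.

Lemma wf_degree_out G i : wf_graph G -> (nvert G <= i)%N -> degree G i = 0%N.
Proof.
move=> wG iG; rewrite /degree big_seq big1 // => e /(wf_ends wG) /andP[e1 e2].
by rewrite !ltn_eqF // (leq_trans _ iG).
Qed.

Lemma wf_total_degree G : wf_graph G -> total_degree G = (size (edges G)).*2.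
Proof.
move=> wG; rewrite /total_degree /degree exchange_big /=.
have E1 (a : nat) : (a < nvert G)%N -> (\sum_(i < nvert G) (a == i) = 1)%N.
  move=> aG; rewrite (bigD1 (Ordinal aG)) //= eqxx big1 ?addn0 // => i.
  by rewrite -val_eqE /= eq_sym => /negPf ->.
rewrite big_seq (eq_bigr (fun=> 2%N)); last first.
  by move=> e /(wf_ends wG) /andP[e1 e2]; rewrite big_split /= !E1.
by rewrite -big_seq big_const_seq count_predT iter_addn_0 mul2n.
Qed.

Lemma wf_loop_graph : wf_graph loop_graph.
Proof.
split=> //= [e|[|i] //= _]; first by rewrite inE => /eqP ->.
by rewrite /degree /= big_seq1.
Qed.

Lemma wf_vertex_step G u : wf_graph G -> (u < nvert G)%N ->
  wf_graph (vertex_step G u).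
Proof.
move=> wG uG; split => //=.
- move=> e; rewrite inE => /orP[/eqP -> /=|/(wf_ends wG)/andP[e1 e2]].
    by rewrite leqnn ltnS ltnW.
  by rewrite !ltnS (ltnW e1) (ltnW e2).
- by rewrite ltnS wf_nvert_le.
- move=> i; rewrite ltnS leq_eqVlt degree_vertex_step => /predU1P[->|iG].
    by rewrite eqxx.
  by rewrite addn_gt0 (wf_degree_gt0 wG iG) orbT.
Qed.

Lemma wf_edge_step G u w : wf_graph G -> (u < nvert G)%N -> (w < nvert G)%N ->
  wf_graph (edge_step G u w).
Proof.
move=> wG uG vG; split => //=.
- by move=> e; rewrite inE => /orP[/eqP -> /=|/(wf_ends wG)//]; apply/andP.
- exact: wf_nvert_gt0.
- exact: leq_trans (wf_nvert_le wG) _.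
- by move=> i iG; rewrite degree_edge_step addn_gt0 (wf_degree_gt0 wG iG) orbT.
Qed.

(** * The one-step expectation *)

Section Chain.
Variables (R : realType) (p : R).
Hypothesis p01 : 0 < p < 1.
Implicit Types (F : mgraph -> R) (G : mgraph) (S : mgraph -> Prop).

Let p0 : 0 < p. Proof. by case/andP: p01. Qed.
Let q0 : 0 < 1 - p. Proof. by case/andP: p01; rewrite subr_gt0. Qed.

Definition ev_vertex F G : R :=
  \sum_(u < nvert G) pa_prob G u * F (vertex_step G u).

Definition ev_edge F G : R :=
  \sum_(u < nvert G) \sum_(w < nvert G)
     pa_prob G u * pa_prob G w * F (edge_step G u w).

(** Conditional expectation of [F] one step after the graph [G]. Iterating it
    gives the law of the process, and turns every probabilistic estimate into an
    inequality between finite sums. *)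
Definition step F G : R := p * ev_vertex F G + (1 - p) * ev_edge F G.

Definition Ex n F : mgraph -> R := iter n step F.

Definition step_closed S := forall G, S G ->
  (forall u, (u < nvert G)%N -> S (vertex_step G u)) /\
  (forall u w, (u < nvert G)%N -> (w < nvert G)%N -> S (edge_step G u w)).

Lemma step_closed_wf : step_closed wf_graph.
Proof.
by move=> G wG; split=> *; [exact: wf_vertex_step|exact: wf_edge_step].
Qed.

Lemma step_closedI S1 S2 : step_closed S1 -> step_closed S2 -> step_closed (fun G => S1 G /\ S2 G).
Proof.
move=> c1 c2 G [/c1[a1 b1] /c2[a2 b2]].
by split=> [u uG|u w uG wG]; split; auto.
Qed.

Lemma pa_prob_ge0 G u : 0 <= pa_prob G u :> R.
Proof. by rewrite divr_ge0 ?ler0n. Qed.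

Lemma pa_probE G u : wf_graph G ->
  pa_prob G u = (degree G u)%:R / (2 * (size (edges G))%:R) :> R.
Proof. by move=> wG; rewrite /pa_prob wf_total_degree // -mul2n natrM. Qed.

Lemma wf_size_gt0 G : wf_graph G -> (0 < size (edges G))%N.
Proof. by move=> wG; rewrite (leq_trans (wf_nvert_gt0 wG)) ?wf_nvert_le. Qed.

Lemma sum_pa_prob G : wf_graph G -> \sum_(u < nvert G) pa_prob G u = 1 :> R.
Proof.
move=> wG; rewrite /pa_prob -mulr_suml -natr_sum -/(total_degree G) divff //.
by rewrite pnatr_eq0 wf_total_degree // double_eq0 -lt0n wf_size_gt0.
Qed.

Lemma sum2_pa_prob G : wf_graph G ->
  \sum_(u < nvert G) \sum_(w < nvert G) pa_prob G u * pa_prob G w = 1 :> R.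
Proof.
move=> wG; rewrite -[RHS](sum_pa_prob wG); apply: eq_bigr => u _.
by rewrite -mulr_sumr sum_pa_prob // mulr1.
Qed.

Lemma step_le F F' G :
  (forall u, (u < nvert G)%N -> F (vertex_step G u) <= F' (vertex_step G u)) ->
  (forall u w, (u < nvert G)%N -> (w < nvert G)%N ->
     F (edge_step G u w) <= F' (edge_step G u w)) ->
  step F G <= step F' G.
Proof.
move=> h1 h2; apply: lerD; rewrite ler_wpM2l ?(ltW p0) ?(ltW q0) //.
  by apply: ler_sum => u _; rewrite ler_wpM2l ?pa_prob_ge0 ?h1.
apply: ler_sum => u _; apply: ler_sum => w _.
by rewrite ler_wpM2l ?mulr_ge0 ?pa_prob_ge0 ?h2.
Qed.

Lemma stepD F F' G : step (fun H => F H + F' H) G = step F G + step F' G.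
Proof.
rewrite /step addrACA -!mulrDr; congr (_ * _ + _ * _).
  by rewrite -big_split; apply: eq_bigr => u _; rewrite /= mulrDr.
rewrite -big_split; apply: eq_bigr => u _; rewrite /= -big_split.
by apply: eq_bigr => w _; rewrite /= mulrDr.
Qed.

Lemma stepZ a F G : step (fun H => a * F H) G = a * step F G.
Proof.
rewrite /step mulrDr !(mulrCA a); congr (_ * _ + _ * _).
  by rewrite mulr_sumr; apply: eq_bigr => u _; rewrite mulrCA.
rewrite mulr_sumr; apply: eq_bigr => u _; rewrite mulr_sumr.
by apply: eq_bigr => w _; rewrite mulrCA.
Qed.

Lemma step_cst a G : wf_graph G -> step (fun=> a) G = a.
Proof.
move=> wG; rewrite /step /ev_vertex /ev_edge -mulr_suml sum_pa_prob //.
under eq_bigr do rewrite -mulr_suml.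
by rewrite -mulr_suml sum2_pa_prob // !mul1r -mulrDl addrC subrK mul1r.
Qed.

Lemma eq_step F F' G : (forall H, F H = F' H) -> step F G = step F' G.
Proof. by move=> e; apply/eqP; rewrite eq_le !step_le // => *; rewrite e. Qed.

Lemma Ex_D m n F G : Ex (m + n) F G = Ex m (Ex n F) G.
Proof. by rewrite /Ex iterD. Qed.

Lemma eq_Ex n F F' G : (forall H, F H = F' H) -> Ex n F G = Ex n F' G.
Proof. by move=> e; elim: n G => [|n IH] G //=; apply: eq_step. Qed.

Lemma Ex_le S n F F' : step_closed S -> (forall H, S H -> F H <= F' H) ->
  forall G, S G -> Ex n F G <= Ex n F' G.
Proof.
move=> cS h; elim: n => [|n IH] G SG; first exact: h.
by have [c1 c2] := cS G SG; apply: step_le => *; apply: IH; auto.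
Qed.

(** Graphs reached from [G] after [n] steps have [n] more edges, so a bound on
    the final functional is only needed there. *)
Lemma Ex_le_size S n F F' G : step_closed S -> S G ->
  (forall H, S H -> size (edges H) = (size (edges G) + n)%N -> F H <= F' H) ->
  Ex n F G <= Ex n F' G.
Proof.
move=> cS; elim: n G => [|n IH] G SG h; first by apply: h; rewrite ?addn0.
have [c1 c2] := cS G SG; apply: step_le => *; apply: IH; auto;
by move=> H SH hH; apply: h => //; rewrite hH addSnnS.
Qed.

Lemma ExD n F F' G : Ex n (fun H => F H + F' H) G = Ex n F G + Ex n F' G.
Proof. by elim: n G => [|n IH] G //=; rewrite -stepD; apply: eq_step. Qed.

Lemma ExZ n a F G : Ex n (fun H => a * F H) G = a * Ex n F G.
Proof. by elim: n G => [|n IH] G //=; rewrite -stepZ; apply: eq_step. Qed.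

Lemma Ex_cst n a G : wf_graph G -> Ex n (fun=> a) G = a.
Proof.
move=> wG; apply/eqP; rewrite eq_le; apply/andP; split.
  elim: n G wG => [|n IH] G wG //=; rewrite -[leRHS](step_cst a wG).
  by apply: step_le => *; apply: IH; [exact: wf_vertex_step|exact: wf_edge_step].
elim: n G wG => [|n IH] G wG //=; rewrite -[leLHS](step_cst a wG).
by apply: step_le => *; apply: IH; [exact: wf_vertex_step|exact: wf_edge_step].
Qed.

Lemma Ex_sum (I : Type) (r : seq I) (Q : pred I) n (F : I -> mgraph -> R) G :
  wf_graph G ->
  Ex n (fun H => \sum_(i <- r | Q i) F i H) G =
  \sum_(i <- r | Q i) Ex n (F i) G.
Proof.
move=> wG; elim: r => [|i r IH].
  by rewrite big_nil -[RHS](Ex_cst n 0 wG); apply: eq_Ex => H; rewrite big_nil.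
rewrite big_cons; case: ifP => Qi.
  by rewrite -IH -ExD; apply: eq_Ex => H; rewrite big_cons Qi.
by rewrite -IH; apply: eq_Ex => H; rewrite big_cons Qi.
Qed.

Lemma Ex_ge0 n F G : (forall H, 0 <= F H) -> 0 <= Ex n F G.
Proof.
move=> h; elim: n G => [|n IH] G //=.
rewrite /step addr_ge0 // mulr_ge0 ?(ltW p0) ?(ltW q0) // sumr_ge0 // => u _.
  by rewrite mulr_ge0 ?pa_prob_ge0.
by rewrite sumr_ge0 // => w _; rewrite !mulr_ge0 ?pa_prob_ge0.
Qed.

(** [Phi] is a supermartingale up to time [T]. *)
Lemma Ex_super S T Phi : step_closed S ->
  (forall H, S H -> (size (edges H) < T)%N -> step Phi H <= Phi H) ->
  forall n G, S G -> (size (edges G) + n <= T)%N -> Ex n Phi G <= Phi G.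
Proof.
move=> cS h; elim=> [|n IH] G SG hT //=.
have [c1 c2] := cS G SG.
apply: le_trans (h G SG _); last by rewrite (leq_trans _ hT) // -addSnnS leq_addr.
by apply: step_le => *; apply: IH => //=; rewrite ?addSnnS; auto.
Qed.

(** Optional stopping when the supermartingale inequality can only be checked
    on a good set of graphs: each visit to the bad set costs at most the
    probability of being there. *)
Lemma Ex_super_leak S T Phi F bad : step_closed S -> (forall H, S H -> wf_graph H) ->
  (forall H, S H -> 0 <= Phi H) -> (forall H, 0 <= bad H) ->
  (forall H, S H -> F H <= Phi H) -> (forall H, S H -> F H <= 1) ->
  (forall H, S H -> (size (edges H) < T)%N ->
     step Phi H <= Phi H \/ 1 <= bad H) ->
  forall n G, S G -> (size (edges G) + n <= T)%N ->
  Ex n F G <= Phi G + \sum_(j < n) Ex j bad G.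
Proof.
move=> cS Swf Phi0 bad0 FPhi F1 h; elim=> [|n IH] G SG hT.
  by rewrite big_ord0 addr0 FPhi.
have [c1 c2] := cS G SG; rewrite big_ord_recl.
have [|good|isbad] := h G SG; first by rewrite (leq_trans _ hT) // -addSnnS leq_addr.
  apply: (@le_trans _ _ (step Phi G + \sum_(j < n) Ex j.+1 bad G)); last first.
    by rewrite lerD // ler_wpDl // ler_sum.
  apply: (@le_trans _ _
     (step (fun H => Phi H + \sum_(j < n) Ex j bad H) G)).
    by apply: step_le => *; apply: IH => //=; rewrite ?addSnnS; auto.
  rewrite stepD lerD // -[leLHS]/(Ex 1 (fun H => \sum_(j < n) Ex j bad H) G).
  by rewrite Ex_sum //; auto.
have le1 : Ex n.+1 F G <= 1.
  by rewrite -[leRHS](Ex_cst n.+1 1 (Swf _ SG)) (Ex_le n.+1 cS).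
apply: le_trans le1 _; rewrite (le_trans isbad) // ler_wpDl ?Phi0 //.
by rewrite ler_wpDr // sumr_ge0 // => j _; exact: Ex_ge0.
Qed.

End Chain.

(** * From the process to the chain *)

Section Law.
Context {R : realType} {d : measure_display} {T : measurableType d}.
Variables (P : probability T R) (p : R).
Variables (Z : nat -> T -> bool) (G : nat -> T -> mgraph).
Hypothesis hG : pa_process P p Z G.
Hypothesis p01 : 0 < p < 1.

Lemma sum_prob_le (I : eqType) (r : seq I) (F : I -> set T) (X : set T) :
  uniq r -> measurable X -> (forall i, measurable (F i)) ->
  (forall i, F i `<=` X) ->
  (forall i j, i != j -> F i `&` F j = set0) ->
  (\sum_(i <- r) P (F i) <= P X)%E.
Proof.
move=> + + mF FX Fd.
have : forall i, i \in r -> F i `<=` X by move=> i _.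
elim: r X {FX} => [|i r IH] X FX /=; first by rewrite big_nil.
move=> /andP[ir ur] mX; rewrite big_cons.
have -> : P X = (P (F i) + P (X `\` F i))%E.
  rewrite -measureU //; [|exact: measurableD|].
    by rewrite setDUK //; apply: FX; rewrite mem_head.
  by rewrite setDIK.
rewrite leeD2l //; apply: IH => //; last exact: measurableD.
move=> j jr x Fjx; split; first by apply: FX Fjx; rewrite inE jr orbT.
move=> Fix; have : (F i `&` F j) x by [].
by rewrite Fd //; apply: contraNneq ir => ->.
Qed.

Lemma measurable_graph_pred (A : pred mgraph) t : (1 <= t)%N ->
  measurable [set x | A (G t x)].
Proof.
move=> t1.
pose dec (c : nat * seq (nat * nat)) := MGraph c.1 c.2.
have -> : [set x | A (G t x)] =
    \bigcup_c (if A (dec c) then [set x | G t x = dec c] else set0).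
  apply/seteqP; split => x /=.
    move=> Ax; exists (nvert (G t x), edges (G t x)) => //.
    rewrite (_ : dec _ = G t x); last by case: (G t x).
    by rewrite Ax /= /dec; case: (G t x).
  by move=> [c _]; case: ifP => // Ac /= ->.
apply: countable_bigcupT_measurable => [|c]; first exact: countableP.
by case: ifP => // _; apply: (pa_measurable_graph hG).
Qed.

Lemma measurable_history t z g : measurable (history Z G t z g).
Proof.
have -> : history Z G t z g =
    (\bigcap_s (if (2 <= s <= t)%N then [set x | Z s x = z s] else setT)) `&`
    (\bigcap_s (if (1 <= s <= t)%N then [set x | G s x = g s] else setT)).
  apply/seteqP; split => x /= [h1 h2]; split.
  - by move=> s _; case: ifP => // /h1.
  - by move=> s _; case: ifP => // /h2.
  - by move=> s hs; have := h1 s I; rewrite hs.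
  - by move=> s hs; have := h2 s I; rewrite hs.
apply: measurableI; apply: bigcapT_measurable => s; case: ifP => // /andP[s1 _].
  exact: (pa_measurable_coin hG).
exact: (pa_measurable_graph hG).
Qed.

Let ext (Y : Type) (t : nat) (f : nat -> Y) (b : Y) s := if s == t.+1 then b else f s.

Lemma history_ext t z g b H : (1 <= t)%N ->
  history Z G t.+1 (ext t z b) (ext t g H) =
  history Z G t z g `&` [set x | Z t.+1 x = b] `&` [set x | G t.+1 x = H].
Proof.
move=> t1; apply/seteqP; split => x /=.
  move=> [h1 h2]; split; [split|]; last 2 first.
  - by have := h1 t.+1; rewrite /ext eqxx => ->; rewrite ?leqnn ?ltnS ?t1.
  - by have := h2 t.+1; rewrite /ext eqxx => ->; rewrite ?leqnn ?ltnS.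
  split=> s /andP[s1 s2].
    by rewrite h1 /ext; [rewrite ltn_eqF|rewrite s1 leqW].
  by rewrite h2 /ext; [rewrite ltn_eqF|rewrite s1 leqW].
move=> [[[h1 h2] h3] h4]; split=> s /andP[s1]; rewrite leq_eqVlt /ext.
  by case: eqP => [->//|_] /=; rewrite ltnS => st; rewrite h1 // s1.
by case: eqP => [->//|_] /=; rewrite ltnS => st; rewrite h2 // s1.
Qed.

(** Restricting to the successors listed by the step laws only loses
    probability, so a lower bound comes without showing that almost surely each
    new graph is one of them. *)
Lemma history_Ex_le (A : pred mgraph) n t z g : (1 <= t)%N -> wf_graph (g t) ->
  (P (history Z G t z g) * (Ex p n (fun H => (A H)%:R) (g t))%:E <=
   P (history Z G t z g `&` [set x | A (G (t + n)%N x)]))%E.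
Proof.
elim: n t z g => [|n IH] t z g t1 wg.
  rewrite /= addn0; case: (boolP (A (g t))) => Ag /=; last by rewrite mule0.
  rewrite mule1 le_measure ?inE //; first exact: measurable_history.
    by apply: measurableI; [exact: measurable_history|exact: measurable_graph_pred].
  by move=> x hx; split => //=; rewrite hx.2 // t1 leqnn.
set h := history Z G t z g; set X := h `&` _.
have mh : measurable h by exact: measurable_history.
have mX : measurable X.
  by apply: measurableI => //; apply: measurable_graph_pred; rewrite addn_gt0 t1.
have mZ b : measurable [set x | Z t.+1 x = b].
  by apply: (pa_measurable_coin hG).
have mH H : measurable [set x | G t.+1 x = H].
  by apply: (pa_measurable_graph hG).
have IHb b H : wf_graph H ->
    (P (h `&` [set x | Z t.+1 x = b] `&` [set x | G t.+1 x = H]) *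
      (Ex p n (fun H => (A H)%:R) H)%:E <=
     P (X `&` [set x | Z t.+1 x = b] `&` [set x | G t.+1 x = H]))%E.
  move=> wH; have eH : ext t g H t.+1 = H by rewrite /ext eqxx.
  have := IH t.+1 (ext t z b) (ext t g H) isT.
  rewrite eH history_ext // -/h => /(_ wH) /le_trans; apply.
  rewrite addSnnS le_measure ?inE //.
  - apply: measurableI; first by do 2 apply: measurableI => //.
    by apply: measurable_graph_pred; rewrite addn_gt0 t1.
  - by do 2 apply: measurableI => //.
  - by move=> x [[[? ?] ?] ?].
pose f H := Ex p n (fun H => (A H)%:R) H.
have Ph : P h = (fine (P h))%:E by rewrite fineK // fin_num_measure.
have coin b : P (h `&` [set x | Z t.+1 x = b]) =
    (fine (P h) * bernoulli_pmf p b)%:E.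
  by rewrite (pa_coin hG) // {1}Ph -EFinM.
have Evert : ((fine (P h) * (p * ev_vertex f (g t)))%:E <=
    P (X `&` [set x | Z t.+1 x = true]))%E.
  apply: le_trans (sum_prob_le (r := enum 'I_(nvert (g t)))
    (F := fun u : 'I_(nvert (g t)) => X `&` [set x | Z t.+1 x = true] `&`
       [set x | G t.+1 x = vertex_step (g t) u]) (enum_uniq _) _ _ _ _).
  - rewrite big_enum /= mulrA mulr_sumr -sumEFin; apply: lee_sum => u _.
    apply: le_trans (IHb true _ (wf_vertex_step wg (ltn_ord u))).
    rewrite (pa_vertex_step hG) // coin /= -!EFinM lee_fin.
    by rewrite !mulrA.
  - by apply: measurableI.
  - by move=> u; do 2 apply: measurableI => //.
  - by move=> u x [].
  - move=> u v uv; apply/seteqP; split => // x [[_ /= ->] [_ /=]].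
    by case=> /ord_inj e; move: uv; rewrite e eqxx.
have Eedge : ((fine (P h) * ((1 - p) * ev_edge f (g t)))%:E <=
    P (X `&` [set x | Z t.+1 x = false]))%E.
  apply: le_trans (sum_prob_le
    (r := enum {: 'I_(nvert (g t)) * 'I_(nvert (g t))})
    (F := fun u : 'I_(nvert (g t)) * 'I_(nvert (g t)) =>
       X `&` [set x | Z t.+1 x = false] `&`
       [set x | G t.+1 x = edge_step (g t) u.1 u.2]) (enum_uniq _) _ _ _ _).
  - rewrite big_enum /= mulrA /ev_edge pair_big /= mulr_sumr -sumEFin.
    apply: lee_sum => u _.
    apply: le_trans (IHb false _ (wf_edge_step wg (ltn_ord u.1) (ltn_ord u.2))).
    rewrite (pa_edge_step hG) // coin /= -!EFinM lee_fin.
    by rewrite !mulrA.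
  - by apply: measurableI.
  - by move=> u; do 2 apply: measurableI => //.
  - by move=> u x [].
  - move=> u v uv; apply/seteqP; split => // x [[_ /= ->] [_ /=]].
    case=> /ord_inj e1 /ord_inj e2; move: uv.
    by rewrite [u]surjective_pairing [v]surjective_pairing e1 e2 eqxx.
rewrite -[Ex p n.+1 _ _]/(step p f (g t)) /step Ph -EFinM mulrDr EFinD; apply: (le_trans (leeD Evert Eedge)).
rewrite -measureU; [|by apply: measurableI|by apply: measurableI|]; last first.
  by apply/seteqP; split => // x [[_ /= ->] [_ /=]].
rewrite le_measure ?inE //; first by apply: measurableU; apply: measurableI.
by move=> x [[]|[]].
Qed.

Lemma Ex_le_prob (A : pred mgraph) n :
  ((Ex p n (fun H => (A H)%:R) loop_graph)%:E <=
   P [set x | A (G n.+1 x)])%E.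
Proof.
have hT : history Z G 1 (fun=> true) (fun=> loop_graph) = setT.
  apply/seteqP; split => // x _; split => s /andP[s1 s2].
    by have := leq_trans s1 s2.
  have -> : s = 1%N by lia.
  exact: (pa_init hG).
have := @history_Ex_le A n 1%N (fun=> true) (fun=> loop_graph) isT wf_loop_graph.
by rewrite hT probability_setT mul1e setTI.
Qed.

End Law.

(** * Moments of a degree *)

Section Moments.
Variables (R : realType) (p : R).
Hypothesis p01 : 0 < p < 1.

Let p0 : 0 < p. Proof. by case/andP: p01. Qed.
Let q0 : 0 < 1 - p. Proof. by case/andP: p01; rewrite subr_gt0. Qed.

Lemma ev_indicator G i (g : bool -> R) : wf_graph G -> (i < nvert G)%N ->
  \sum_(u < nvert G) pa_prob G u * g (u == i :> nat) =
  g false + pa_prob G i * (g true - g false).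
Proof.
move=> wG iG; rewrite (bigD1 (Ordinal iG)) //= eqxx.
rewrite (eq_bigr (fun u : 'I_(nvert G) => pa_prob G u * g false)); last first.
  by move=> u; rewrite -val_eqE /= => /negPf ->.
rewrite -mulr_suml; have := sum_pa_prob R wG.
rewrite (bigD1 (Ordinal iG)) //= => /(canRL (addKr _)) ->.
ring.
Qed.

(** [rise r d] is Gamma(d + r) / (Gamma(d) Gamma(1 + r)), which grows like
    [d `^ r]. One more half-edge multiplies it by exactly [1 + r / d], while the
    chance of that is proportional to [d]: hence its conditional expectation
    grows at a rate that does not depend on [d] to first order. *)
Definition rise (r : R) (d : nat) : R := \prod_(1 <= k < d) (1 + r / k%:R).

Lemma rise1 r : rise r 1 = 1.
Proof. by rewrite /rise big_geq. Qed.

Lemma riseS r d : (0 < d)%N -> rise r d.+1 = rise r d * (1 + r / d%:R).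
Proof. by move=> d0; rewrite /rise big_nat_recr. Qed.

Lemma rise_ge0 r d : -1 <= r -> 0 <= rise r d.
Proof.
move=> r1; rewrite /rise big_seq_cond prodr_ge0 // => k.
rewrite andbT mem_index_iota => /andP[k1 _].
rewrite -lerBlDl sub0r ler_pdivlMr ?ltr0n //.
by rewrite mulN1r (le_trans _ r1) // lerN2 ler1n.
Qed.

Lemma step_rise r i G : -1 <= r -> wf_graph G -> (i < nvert G)%N ->
  step p (fun H => rise r (degree H i)) G <=
  rise r (degree G i) * (1 + (1 - p / 2) * r / (size (edges G))%:R +
    `|r * (r - 1)| / (size (edges G))%:R ^+ 2).
Proof.
move=> r1 wG iG; set s := size (edges G); set d := degree G i.
have d0 : (0 < d)%N by exact: wf_degree_gt0.
have s0 : 0 < s%:R :> R by rewrite ltr0n wf_size_gt0.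
have dR0 : 0 < d%:R :> R by rewrite ltr0n.
have dS0 : 0 < d.+1%:R :> R by rewrite ltr0n.
have piE : pa_prob G i = d%:R / (2 * s%:R) :> R by rewrite pa_probE.
have iN : (nvert G == i) = false by rewrite gtn_eqF.
have EV : ev_vertex (fun H => rise r (degree H i)) G =
    rise r d * (1 + r / (2 * s%:R)).
  pose g (b : bool) := rise r (b + d).
  rewrite /ev_vertex.
  rewrite (eq_bigr (fun u : 'I_(nvert G) => pa_prob G u * g (u == i :> nat)));
    last by move=> u _; rewrite degree_vertex_step iN.
  rewrite ev_indicator // /g add0n add1n riseS // piE.
  by field; rewrite ?gt_eqF // mulr_gt0.
have EE : ev_edge (fun H => rise r (degree H i)) G =
    rise r d * (1 + r / s%:R + d%:R / (4 * s%:R ^+ 2 * d.+1%:R) * (r * (r - 1))).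
  pose g (b : bool) := rise r (b + d) * (1 + pa_prob G i * (r / (b + d)%:R)).
  rewrite /ev_edge.
  rewrite (eq_bigr (fun u : 'I_(nvert G) => pa_prob G u * g (u == i :> nat)));
    last first.
    move=> u _; under eq_bigr do rewrite -mulrA.
    rewrite -mulr_sumr; congr (_ * _).
    pose h (b : bool) := rise r (b + ((u == i :> nat) + d)).
    rewrite (eq_bigr (fun w : 'I_(nvert G) => pa_prob G w * h (w == i :> nat)));
      last by move=> w _; rewrite degree_edge_step /h addnCA addnA.
    rewrite ev_indicator // /h /g add0n add1n riseS ?addn_gt0 ?d0 ?orbT //.
    by ring.
  rewrite ev_indicator // /g !add0n !add1n riseS // piE.
  by rewrite -natr1; field; rewrite ?(nat1r, natr1) !gt_eqF.
rewrite /step EV EE !(mulrCA _ (rise r d)) -mulrDr.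
rewrite ler_wpM2l ?rise_ge0 //.
have K : (1 - p) * (d%:R / (4 * s%:R ^+ 2 * d.+1%:R) * (r * (r - 1))) <=
    `|r * (r - 1)| / s%:R ^+ 2.
  apply: (@le_trans _ _ (1 * (d%:R / (4 * s%:R ^+ 2 * d.+1%:R) * `|r * (r - 1)|))).
    apply: (@le_trans _ _ ((1 - p) * (d%:R / (4 * s%:R ^+ 2 * d.+1%:R) * `|r * (r - 1)|))).
      by rewrite ler_wpM2l ?(ltW q0) // ler_wpM2l ?ler_norm // divr_ge0 ?ler0n //
        !mulr_ge0 ?exprn_ge0 ?ler0n.
    by rewrite ler_wpM2r ?gerBl ?(ltW p0) // mulr_ge0 ?normr_ge0 // divr_ge0
      ?ler0n // !mulr_ge0 ?exprn_ge0 ?ler0n.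
  rewrite mul1r mulrC ler_wpM2l ?normr_ge0 //.
  rewrite ler_pdivrMr ?mulr_gt0 ?exprn_gt0 //.
  have -> : (s%:R ^+ 2)^-1 * (4 * s%:R ^+ 2 * d.+1%:R) = (4 * d.+1)%:R :> R.
    by rewrite natrM; field; rewrite gt_eqF.
  by rewrite ler_nat; lia.
have -> : p * (1 + r / (2 * s%:R)) + (1 - p) *
    (1 + r / s%:R + d%:R / (4 * s%:R ^+ 2 * d.+1%:R) * (r * (r - 1))) =
    1 + (1 - p / 2) * r / s%:R +
    (1 - p) * (d%:R / (4 * s%:R ^+ 2 * d.+1%:R) * (r * (r - 1))).
  by rewrite -natr1; field; rewrite ?(nat1r, natr1) !gt_eqF.
exact: lerD.
Qed.

(** [decay b K s] plays the role of [s `^ - b]; the bounded factor absorbs the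
    second-order terms of a growth rate [b / s]. *)
Definition decay (b K : R) (s : nat) : R := expR (K / s%:R - b * ln s%:R).

Lemma decay_gt0 b K s : 0 < decay b K s.
Proof. exact: expR_gt0. Qed.

Lemma ln_natS (s : nat) : (0 < s)%N ->
  1 / s.+1%:R <= ln (s.+1%:R : R) - ln s%:R <= 1 / s%:R.
Proof.
move=> s0; have sR : 0 < s%:R :> R by rewrite ltr0n.
have sS : 0 < s.+1%:R :> R by rewrite ltr0n.
apply/andP; split.
  have := @le_ln1Dx R (- (1 / s.+1%:R)).
  rewrite ltrN2 div1r invf_lt1 // ltr1n ltnS s0 => /(_ isT).
  have -> : 1 - s.+1%:R^-1 = s%:R / s.+1%:R :> R.
    by rewrite -natr1; field; rewrite ?(nat1r, natr1) gt_eqF.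
  rewrite ln_div ?posrE //; move: (ln _) (ln _) (_^-1) => a b c; lra.
have := @le_ln1Dx R (1 / s%:R).
rewrite (lt_trans (@ltrN10 R)) ?divr_gt0 // => /(_ isT).
have -> : 1 + 1 / s%:R = s.+1%:R / s%:R :> R.
  by rewrite -natr1; field; rewrite gt_eqF.
by rewrite ln_div ?posrE.
Qed.

Lemma decayS b K0 K s : (0 < s)%N -> 0 <= K0 -> `|b| + 2 * K0 <= K ->
  (1 + b / s%:R + K0 / s%:R ^+ 2) * decay b K s.+1 <= decay b K s.
Proof.
move=> s0 K00 hK; have sR : 0 < s%:R :> R by rewrite ltr0n.
have sS : 0 < s.+1%:R :> R by rewrite ltr0n.
have := expR_ge1Dx (b / s%:R + K0 / s%:R ^+ 2); rewrite addrA => h.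
apply: (le_trans (ler_wpM2r (ltW (decay_gt0 _ _ _)) h)).
rewrite -expRD ler_expR.
have /andP[l1 l2] := ln_natS s0.
set L1 := ln s.+1%:R in l1 l2 *; set L := ln s%:R in l1 l2 *.
pose w : R := 1 / (s%:R * s.+1%:R).
have w0 : 0 < w by rewrite divr_gt0 ?mulr_gt0.
have e1 : 1 / s%:R - 1 / s.+1%:R = w :> R.
  by rewrite /w -natr1; field; rewrite ?(nat1r, natr1) !gt_eqF.
have hb : b * (1 / s%:R - (L1 - L)) <= `|b| * w.
  apply: le_trans (ler_norm _) _; rewrite normrM ler_wpM2l ?normr_ge0 //.
  by rewrite ger0_norm ?subr_ge0 // -e1 lerD2l lerN2.
have hK0 : K0 / s%:R ^+ 2 <= 2 * K0 * w.
  rewrite (mulrC 2) -mulrA ler_wpM2l // /w mulrA mulr1.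
  rewrite ler_pdivlMr ?mulr_gt0 // expr2 -natr1.
  have -> : (s%:R * s%:R)^-1 * (s%:R * (s%:R + 1)) = 1 + 1 / s%:R :> R.
    by field; rewrite gt_eqF.
  suff : 1 / s%:R <= 1 :> R by lra.
  by rewrite div1r invf_le1 // ler1n.
have hKw : (`|b| + 2 * K0) * w <= K * w by rewrite ler_wpM2r // ltW.
have e2 : K / s%:R = K / s.+1%:R + K * w.
  by rewrite -e1 !div1r; ring.
rewrite e2; move: hb hK0 hKw; rewrite div1r !mulrBr (mulrDl `|b|).
move: (K / s.+1%:R) (b / s%:R) (K0 / s%:R ^+ 2) => x y z.
by move: (b * L) (b * L1) (K * w) (2 * K0 * w) (`|b| * w) => *; lra.
Qed.


Let c : R := 1 - p / 2.

(** Large enough for [decayS] to absorb the error term of [step_rise]. *)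
Definition rate (r : R) : R := `|c * r| + 2 * `|r * (r - 1)|.

Lemma step_rise_decay r i G : -1 <= r -> wf_graph G -> (i < nvert G)%N ->
  step p (fun H => rise r (degree H i) * decay (c * r) (rate r) (size (edges H))) G
  <= rise r (degree G i) * decay (c * r) (rate r) (size (edges G)).
Proof.
move=> r1 wG iG; set s := size (edges G).
have -> : step p (fun H => rise r (degree H i) *
     decay (c * r) (rate r) (size (edges H))) G =
   decay (c * r) (rate r) s.+1 * step p (fun H => rise r (degree H i)) G.
  rewrite -stepZ; apply/eqP; rewrite eq_le.
  by apply/andP; split; apply: (step_le p01) => *; rewrite mulrC.
apply: (le_trans (ler_wpM2l (ltW (decay_gt0 _ _ _)) (step_rise r1 wG iG))).
rewrite mulrCA ler_wpM2l ?rise_ge0 // mulrC.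
by apply: decayS; rewrite ?wf_size_gt0 ?normr_ge0.
Qed.

Lemma Ex_rise_le r i n G : -1 <= r -> wf_graph G -> (i < nvert G)%N ->
  Ex p n (fun H => rise r (degree H i) * decay (c * r) (rate r) (size (edges H))) G
  <= rise r (degree G i) * decay (c * r) (rate r) (size (edges G)).
Proof.
move=> r1 wG iG.
apply: (Ex_super p01 (S := fun H => wf_graph H /\ (i < nvert H)%N)
  (T := size (edges G) + n)) => //.
  apply: step_closedI; first exact: step_closed_wf.
  by move=> H iH; split=> //= u uH; rewrite ltnW.
by move=> H [wH iH] _; exact: step_rise_decay.
Qed.

End Moments.

Section DegreeTails.
Variables (R : realType) (p : R).
Hypothesis p01 : 0 < p < 1.

Let c : R := 1 - p / 2.
Let c0 : 0 < c. Proof. by case/andP: p01 => *; rewrite /c; lra. Qed.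

Lemma rate_ge0 r : 0 <= rate p r.
Proof. by rewrite addr_ge0 ?mulr_ge0 ?normr_ge0. Qed.

Lemma powR_gt0E (x a : R) : 0 < x -> x `^ a = expR (a * ln x).
Proof. by move=> x0; rewrite /powR gt_eqF. Qed.

Lemma decay_ge (b K : R) s : 0 <= K -> (0 < s)%N -> s%:R `^ (- b) <= decay b K s.
Proof.
move=> K0 s0; rewrite powR_gt0E ?ltr0n // ler_expR mulNr lerDr.
by rewrite divr_ge0.
Qed.

Lemma decay_le (b K : R) s : 0 <= K -> (0 < s)%N ->
  decay b K s <= expR K * s%:R `^ (- b).
Proof.
move=> K0 s0; rewrite powR_gt0E ?ltr0n // -expRD ler_expR mulNr lerD2r.
by rewrite ler_pdivrMr ?ltr0n // ler_peMr // ler1n.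
Qed.

Lemma decay_anti (b K : R) s s' : 0 <= b -> 0 <= K -> (0 < s)%N ->
  (s <= s')%N -> decay b K s' <= decay b K s.
Proof.
move=> b0 K0 s0 ss'; have s'0 : (0 < s')%N by exact: leq_trans ss'.
rewrite ler_expR lerB //.
  by rewrite ler_wpM2l // lef_pV2 ?posrE ?ltr0n // ler_nat.
by rewrite ler_wpM2l // ler_ln ?posrE ?ltr0n // ler_nat.
Qed.

(** ** Upper tail *)

(** Before its birth a vertex is credited with the largest value it could have
    at birth, since vertex [i] cannot be born before time [i.+1]. *)
Lemma Ex_rise_birth r i n : 0 <= r ->
  Ex p n (fun H => if (i < nvert H)%N
     then rise r (degree H i) * decay (c * r) (rate p r) (size (edges H))
     else decay (c * r) (rate p r) i.+1) loop_graph <=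
  (1 + r) * decay (c * r) (rate p r) i.+1.
Proof.
move=> r0; set K := rate p r; set Phi := fun H : mgraph => _.
have b0 : 0 <= c * r by rewrite mulr_ge0 // ltW.
have r1 : -1 <= r by rewrite (le_trans _ r0).
apply: (@le_trans _ _ (Phi loop_graph)).
  apply: (Ex_super p01 (S := wf_graph) (T := n.+1)) => //; first exact: step_closed_wf.
    move=> H wH _; rewrite {2}/Phi; case: ifP => iH.
      apply: (le_trans _ (step_rise_decay p01 r1 wH iH)).
      by apply: (step_le p01) => * /=; rewrite /Phi /= ?iH ?(leqW iH).
    rewrite -[leRHS](step_cst p _ wH).
    apply: (step_le p01) => [u uH|u w _ _]; rewrite /Phi /= ?iH // ltnS.
    case: ifP => // iH'; have iE : i = nvert H by apply/eqP; rewrite eqn_leq iH' leqNgt iH.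
    have -> : degree (vertex_step H u) i = 1%N.
      rewrite degree_vertex_step iE eqxx (ltn_eqF uH) wf_degree_out //.
    rewrite rise1 mul1r decay_anti // ?rate_ge0 //.
    by rewrite ltnS iE wf_nvert_le.
  exact: wf_loop_graph.
have d0 := decay_gt0 (c * r) K i.+1.
rewrite /Phi /=; case: i d0 {Phi} => [|i] d0 /=.
  rewrite /degree /= big_seq1 /= riseS // rise1 mul1r divr1.
  by [].
by rewrite ler_peMl ?lerDl // ltW.
Qed.

Lemma rise_natE r d : rise r%:R d.+1 = 'C(d + r, r)%:R :> R.
Proof.
elim: d => [|d IH]; first by rewrite rise1 add0n binn.
rewrite riseS // IH.
have d0 : d.+1%:R != 0 :> R by rewrite pnatr_eq0.
apply: (mulIf d0); rewrite -mulrA mulrDl mul1r mulfVK // -natrD -!natrM.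
congr (_%:R); have := mul_bin_down (d.+1 + r) r.
by rewrite addnK addSn /= => /esym; rewrite mulnC => ->; rewrite mulnC -addSn.
Qed.

Lemma expn_le_rise r d : (0 < d)%N -> d%:R ^+ r <= r`!%:R * rise r%:R d :> R.
Proof.
case: d => // d _; rewrite rise_natE -natrX -natrM ler_nat mulnC bin_ffact.
elim: r => [|r IH]; first by rewrite expn0 ffactn0.
by rewrite expnS addnS ffactSS leq_mul // ltnS leq_addr.
Qed.

(** The degree of vertex [i] at time [s] is typically of order
    [(s / (i + 1)) `^ c] at most, as it is born at time [i + 1] or later. *)
Definition heavy (D : R) (i : nat) (H : mgraph) : bool :=
  (i < nvert H)%N &&
  (D * ((size (edges H))%:R / i.+1%:R) `^ c < (degree H i)%:R).

Definition has_heavy (D : R) (H : mgraph) : bool :=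
  [exists i : 'I_(nvert H), heavy D i H].

Definition heavy_cst (r : nat) : R := r`!%:R * (1 + r%:R) * expR (rate p r%:R).

Lemma heavy_cst_ge0 r : 0 <= heavy_cst r.
Proof. by rewrite !mulr_ge0 ?expR_ge0 // addr_ge0. Qed.

(** Markov's inequality for the moment of order [r]. *)
Lemma Ex_heavy D i n r : 0 < D ->
  Ex p n (fun H => (heavy D i H)%:R) loop_graph <= heavy_cst r / D ^+ r.
Proof.
move=> D0; set K := rate p r%:R; pose b := c * r%:R.
pose X : R := (n.+1%:R / i.+1%:R) `^ c.
have X0 : 0 < X by rewrite powR_gt0 ?divr_gt0.
have b0 : 0 <= b by rewrite mulr_ge0 // ltW.
have r1 : -1 <= r%:R :> R by rewrite (le_trans _ (ler0n _ r)).
have XE : X ^+ r = n.+1%:R `^ b / i.+1%:R `^ b.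
  rewrite -powR_mulrn ?powR_ge0 // -powRrM powRM ?invr_ge0 ?ler0n //.
  by rewrite -powR_inv1 // -powRrM mulN1r powRN.
pose A := r`!%:R / ((D * X) ^+ r) / decay b K n.+1.
have A0 : 0 <= A.
  by rewrite !divr_ge0 ?ler0n ?exprn_ge0 ?mulr_ge0 ?(ltW D0) ?(ltW X0) ?(ltW (decay_gt0 _ _ _)).
apply: (@le_trans _ _ (Ex p n (fun H => A * (if (i < nvert H)%N
     then rise r%:R (degree H i) * decay b K (size (edges H))
     else decay b K i.+1)) loop_graph)).
  apply: (Ex_le_size p01 step_closed_wf); first exact: wf_loop_graph.
  move=> H wH; rewrite /= add1n => hs; rewrite /heavy hs.
  case: ifP => iH /=; last by rewrite mulr_ge0 // ltW ?decay_gt0.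
  case: ltP => hd; last by rewrite mulr_ge0 // mulr_ge0 ?rise_ge0 // ltW ?decay_gt0.
  rewrite /A mulrACA mulVf ?gt_eqF ?decay_gt0 // mulr1 mulrAC.
  rewrite ler_pdivlMr ?exprn_gt0 ?mulr_gt0 // mul1r.
  rewrite (le_trans _ (expn_le_rise r (wf_degree_gt0 wH iH))) //.
  by rewrite lerXn2r ?nnegrE ?ler0n ?mulr_ge0 ?(ltW D0) ?(ltW X0) // ltW.
rewrite (ExZ p01); have h := Ex_rise_birth i n (ler0n R r).
apply: (le_trans (ler_wpM2l A0 h)).
have dn := decay_ge b (rate_ge0 r%:R) (ltn0Sn n).
have di := decay_le b (rate_ge0 r%:R) (ltn0Sn i).
have n0 : 0 < n.+1%:R `^ b :> R by rewrite powR_gt0.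
have i0 : 0 < i.+1%:R `^ b :> R by rewrite powR_gt0.
have quot : decay b K i.+1 / decay b K n.+1 <= expR K * X ^+ r.
  rewrite ler_pdivrMr ?decay_gt0 // (le_trans di) // XE powRN -mulrA.
  rewrite ler_wpM2l ?expR_ge0 // mulrAC ler_peMl ?invr_ge0 ?(ltW i0) //.
  have nn : n.+1%:R `^ b * n.+1%:R `^ (- b) = 1 :> R.
    by rewrite powRN mulfV // gt_eqF.
  rewrite -[leLHS]nn.
  by rewrite ler_wpM2l // ltW.
have -> : A * ((1 + r%:R) * decay b K i.+1) =
    r`!%:R * (1 + r%:R) / (D * X) ^+ r * (decay b K i.+1 / decay b K n.+1).
  by rewrite /A; ring.
have Dr : 0 < (D * X) ^+ r by rewrite exprn_gt0 ?mulr_gt0.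
apply: (@le_trans _ _ (r`!%:R * (1 + r%:R) / (D * X) ^+ r * (expR K * X ^+ r))).
  by rewrite ler_wpM2l // divr_ge0 ?(ltW Dr) // mulr_ge0 ?addr_ge0.
rewrite exprMn invfM.
have -> : r`!%:R * (1 + r%:R) * ((D ^+ r)^-1 * (X ^+ r)^-1) *
   (expR K * X ^+ r) = heavy_cst r / D ^+ r * ((X ^+ r)^-1 * X ^+ r).
  by rewrite /heavy_cst -/K; ring.
by rewrite mulVf ?mulr1 // gt_eqF ?exprn_gt0.
Qed.

Lemma Ex_has_heavy D n r : 0 < D ->
  Ex p n (fun H => (has_heavy D H)%:R) loop_graph <=
  n.+1%:R * (heavy_cst r / D ^+ r).
Proof.
move=> D0.
apply: (@le_trans _ _
  (Ex p n (fun H => \sum_(i < n.+1) (heavy D i H)%:R) loop_graph)).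
  apply: (Ex_le_size p01 step_closed_wf); first exact: wf_loop_graph.
  move=> H wH; rewrite /= add1n => hs.
  case: (boolP (has_heavy D H)) => [/existsP[[i iH] /= hi]|_]; last first.
    by rewrite sumr_ge0.
  have iN : (i < n.+1)%N by rewrite (leq_trans iH) // -hs wf_nvert_le.
  by rewrite (bigD1 (Ordinal iN)) //= hi lerDl sumr_ge0.
rewrite (Ex_sum p01) //; last exact: wf_loop_graph.
apply: (@le_trans _ _ (\sum_(i < n.+1) heavy_cst r / D ^+ r)).
  by apply: ler_sum => i _; exact: Ex_heavy.
by rewrite sumr_const card_ord mulr_natl.
Qed.

(** ** Lower tail *)

(** [rise (- 1 / 2) d] is of order [d `^ (- 1 / 2)]. *)
Lemma rise_half_ge d : (0 < d)%N -> 1 <= 4 * d%:R * rise (- 2^-1) d ^+ 2 :> R.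
Proof.
case: d => // -[_|d _]; first by rewrite rise1; lra.
(* the sharper bound with d - 1 in place of d is preserved by the recursion *)
suff : 1 <= 4 * d.+1%:R * rise (- 2^-1) d.+2 ^+ 2 :> R.
  by move/le_trans; apply; rewrite ler_wpM2r ?sqr_ge0 // ler_pM2l // ler_nat.
elim: d => [|d IH]; first by rewrite riseS // rise1; lra.
apply: le_trans IH _; rewrite (riseS _ (ltn0Sn d.+1)) exprMn.
set x := rise _ _ ^+ 2; have x0 : 0 <= x by exact: sqr_ge0.
have d0 : 0 < d.+1%:R :> R by [].
rewrite [leRHS]mulrA [leRHS]mulrAC ler_wpM2r //.
rewrite -[d.+2]addn1 natrD; move: d0; move: (d.+1%:R) => y y0.
have -> : 4 * (y + 1) * (1 + - 2^-1 / (y + 1)) ^+ 2 = 4 * y + (y + 1)^-1.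
  by field; lra.
by rewrite lerDl invr_ge0; lra.
Qed.

Lemma rise_half_le1 d : rise (- 2^-1) d <= 1 :> R.
Proof.
rewrite /rise big_seq_cond prodr_ile1 // => k; rewrite andbT mem_index_iota => /andP[k1 _].
have kR : 1 <= k%:R :> R by rewrite ler1n.
have k0 : 0 < k%:R :> R by lra.
rewrite mulNr; apply/andP; split; last by rewrite gerDl oppr_le0 divr_ge0; lra.
by rewrite subr_ge0 ler_pdivrMr //; lra.
Qed.

(** Markov's inequality for the moment of order [- 1 / 2], which is a
    supermartingale up to a deterministic factor. *)
Lemma Ex_light i n (la : R) G : 0 < la -> wf_graph G -> (i < nvert G)%N ->
  Ex p n (fun H => ((degree H i)%:R <= la)%R%:R) G <=
  2 * expR (rate p (- 2^-1)) *
  (la * ((size (edges G))%:R / (size (edges G) + n)%:R) `^ c) `^ 2^-1.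
Proof.
move=> la0 wG iG; set s := size (edges G); set K := rate p _.
have r1 : -1 <= - 2^-1 :> R by lra.
have s0 : (0 < s)%N by exact: wf_size_gt0.
have sn0 : (0 < s + n)%N by rewrite addn_gt0 s0.
pose b := c * - 2^-1; pose dec := decay b K.
have deE : 0 < dec (s + n)%N by exact: decay_gt0.
pose A := 2 * la `^ 2^-1 / dec (s + n)%N.
have A0 : 0 <= A by rewrite divr_ge0 ?(ltW deE) // mulr_ge0 ?powR_ge0.
apply: (@le_trans _ _ (Ex p n (fun H => A * (rise (- 2^-1) (degree H i) *
     dec (size (edges H)))) G)).
  apply: (Ex_le_size p01 (S := fun H => wf_graph H /\ (i < nvert H)%N)) => //.
    apply: step_closedI; first exact: step_closed_wf.
    by move=> H iH; split=> //= u uH; rewrite ltnW.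
  move=> H [wH iH] ->; rewrite -/s /A mulrACA mulVf ?gt_eqF // mulr1.
  have ri0 := rise_ge0 (degree H i) r1.
  case: (leP (degree H i)%:R la) => hd /=; last by rewrite !mulr_ge0 ?powR_ge0.
  rewrite powR12_sqrt ?(ltW la0) //.
  rewrite -(@ler_pXn2r _ 2) ?nnegrE ?mulr_ge0 ?sqrtr_ge0 //.
  rewrite expr1n !exprMn sqr_sqrtr ?(ltW la0) //.
  apply: le_trans (rise_half_ge (wf_degree_gt0 wH iH)) _.
  by rewrite ler_wpM2r ?sqr_ge0 //; lra.
rewrite (ExZ p01); have h := Ex_rise_le p01 n r1 wG iG.
apply: (le_trans (ler_wpM2l A0 h)).
have dn := decay_ge b (rate_ge0 (- 2^-1)) sn0.
have di := decay_le b (rate_ge0 (- 2^-1)) s0.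
rewrite -/s -/c -/K -/b -/dec in h dn di *.
apply: (@le_trans _ _ (A * (expR K * s%:R `^ (- b)))).
  rewrite ler_wpM2l // (le_trans _ di) // ler_piMl ?rise_half_le1 //.
  by rewrite ltW // decay_gt0.
have sR : 0 < s%:R :> R by rewrite ltr0n.
have snR : 0 < (s + n)%:R :> R by rewrite ltr0n.
rewrite (powRM _ (ltW la0) (powR_ge0 _ _)) -powRrM.
have -> : c / 2 = - b by rewrite /b; ring.
rewrite powRM ?invr_ge0 ?ler0n // -(powR_inv1 (ler0n _ (s + n))) -powRrM mulN1r opprK.
have -> : A * (expR K * s%:R `^ (- b)) =
   2 * expR K * (la `^ 2^-1 * (s%:R `^ (- b) * (dec (s + n)%N)^-1)).
  by rewrite /A; ring.
rewrite ler_wpM2l ?mulr_ge0 ?expR_ge0 // ler_wpM2l ?powR_ge0 //.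
rewrite ler_wpM2l ?powR_ge0 // -[X in _ <= X]invrK -powRN lef_pV2 ?posrE //.
by rewrite powR_gt0.
Qed.

End DegreeTails.

(** * Few triangles *)

Section ExpectProd3.
Variable R : realType.

(** As at most one factor is raised by a unit, the expectation only has the terms
    of order 0 and 1 in [q1], [q2], [q3] of the product on the right. *)
Lemma expect_prod3 (I : finType) (w F : I -> R) (x1 x2 x3 q1 q2 q3 : R)
    (e1 e2 e3 : pred I) :
  (forall a, 0 <= w a) -> \sum_a w a = 1 ->
  0 <= x1 -> 0 <= x2 -> 0 <= x3 ->
  \sum_a w a * (e1 a)%:R <= q1 -> \sum_a w a * (e2 a)%:R <= q2 ->
  \sum_a w a * (e3 a)%:R <= q3 ->
  (forall a, [&& ~~ (e1 a && e2 a), ~~ (e1 a && e3 a) & ~~ (e2 a && e3 a)]) ->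
  (forall a, F a <= (x1 + (e1 a)%:R) * (x2 + (e2 a)%:R) * (x3 + (e3 a)%:R)) ->
  \sum_a w a * F a <= (x1 + q1) * (x2 + q2) * (x3 + q3).
Proof.
move=> w0 w1 x10 x20 x30 h1 h2 h3 ex hF.
have pos (e : pred I) q : \sum_a w a * (e a)%:R <= q -> 0 <= q.
  by apply: le_trans; apply: sumr_ge0 => a _; rewrite mulr_ge0.
have q10 := pos _ _ h1; have q20 := pos _ _ h2; have q30 := pos _ _ h3.
apply: (@le_trans _ _ (\sum_a (w a * (x1 * x2 * x3) +
   (w a * (e1 a)%:R * (x2 * x3) + (w a * (e2 a)%:R * (x1 * x3) +
    w a * (e3 a)%:R * (x1 * x2)))))).
  apply: ler_sum => a _; rewrite -!mulrA -!mulrDr ler_wpM2l //.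
  apply: (le_trans (hF a)); have := ex a.
  by case: (e1 a); case: (e2 a); case: (e3 a) => //= _; lra.
rewrite !big_split /= -!mulr_suml w1 mul1r.
apply: (@le_trans _ _ (x1 * x2 * x3 + (q1 * (x2 * x3) + (q2 * (x1 * x3) +
    q3 * (x1 * x2))))).
  by rewrite lerD2l !lerD // ler_wpM2r // mulr_ge0.
have : 0 <= x1 * (q2 * q3) + x2 * (q1 * q3) + x3 * (q1 * q2) + q1 * (q2 * q3).
  by rewrite !addr_ge0 // !mulr_ge0.
by lra.
Qed.

Lemma harmonic_le n : \sum_(1 <= u < n.+2) (u%:R : R)^-1 <= 1 + ln n.+1%:R.
Proof.
elim: n => [|n IH]; first by rewrite big_nat1 invr1 ln1 addr0.
rewrite big_nat_recr //=.
have /andP[h _] := @ln_natS R n.+1 isT.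
apply: (le_trans (lerD IH (lexx _))); rewrite -addrA lerD2l -lerBrDl.
by rewrite -div1r.
Qed.

End ExpectProd3.

Section Triangles.
Variables (R : realType) (p : R).
Hypothesis p01 : 0 < p < 1.

Let p0 : 0 < p. Proof. by case/andP: p01. Qed.
Let q0 : 0 < 1 - p. Proof. by case/andP: p01; rewrite subr_gt0. Qed.
Let c : R := 1 - p / 2.
Let c0 : 0 < c. Proof. by case/andP: p01 => *; rewrite /c; lra. Qed.
Let c1 : c <= 1. Proof. by case/andP: p01 => *; rewrite /c; lra. Qed.
Let c2 : 0 <= 2 * c - 1. Proof. by case/andP: p01 => *; rewrite /c; lra. Qed.

Variables (D : R) (T : nat).
Hypothesis D1 : 1 <= D.
Let D0 : 0 < D. Proof. exact: lt_le_trans D1. Qed.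

(** [lateness i] is the factor by which a typical degree is reduced when the
    vertex is born at time [i.+1] instead of time 1. *)
Let lateness (i : nat) : R := i.+1%:R `^ c.
Let lateness_gt0 i : 0 < lateness i. Proof. exact: powR_gt0. Qed.

Lemma light_degree H i : wf_graph H -> ~~ has_heavy p D H ->
  (degree H i)%:R <= D * (size (edges H))%:R `^ c / lateness i.
Proof.
move=> wH; rewrite negb_exists => /forallP nh; case: (ltnP i (nvert H)) => iH.
  have := nh (Ordinal iH); rewrite /heavy /= iH /= -leNgt => /le_trans; apply.
  rewrite -mulrA ler_wpM2l ?(ltW D0) // powRM ?invr_ge0 // ler_wpM2l ?powR_ge0 //.
  by rewrite /lateness -powRN -(powR_inv1 (ler0n _ _)) -powRrM mulN1r.
by rewrite wf_degree_out // divr_ge0 ?mulr_ge0 ?powR_ge0 ?(ltW D0).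
Qed.

(** As long as no vertex is heavy, [edge_rate i j s] bounds the probability that
    the step after time [s] is an edge-step joining [i] and [j], and
    [birth_rate i j] the probability that [j], when it is born, is attached
    to [i]. *)
Definition edge_rate i j (s : nat) : R :=
  D ^+ 2 * s%:R `^ (2 * c - 2) / (lateness i * lateness j).

Definition birth_rate i j : R :=
  D * T%:R `^ (2 * c - 1) / (lateness i * lateness j).

Definition rest_rate i j s : R := \sum_(s <= u < T) edge_rate i j u.

(** Bounds the conditional probability, given the graph, that [i < j] are joined
    by time [T] without any vertex becoming heavy before. *)
Definition pair_pot i j (H : mgraph) : R :=
  (if (j < nvert H)%N then (adj H i j)%:R else birth_rate i j) +
  rest_rate i j (size (edges H)).

Lemma edge_rate_ge0 i j s : 0 <= edge_rate i j s.
Proof.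
by rewrite divr_ge0 ?mulr_ge0 ?exprn_ge0 ?powR_ge0 ?(ltW D0) ?(ltW (lateness_gt0 _)).
Qed.

Lemma rest_rate_ge0 i j s : 0 <= rest_rate i j s.
Proof. by rewrite sumr_ge0 // => u _; exact: edge_rate_ge0. Qed.

Lemma birth_rate_ge0 i j : 0 <= birth_rate i j.
Proof.
by rewrite divr_ge0 ?mulr_ge0 ?powR_ge0 ?(ltW D0) ?(ltW (lateness_gt0 _)).
Qed.

Lemma pair_pot_ge0 i j H : 0 <= pair_pot i j H.
Proof.
by rewrite addr_ge0 ?rest_rate_ge0 //; case: ifP => // _; exact: birth_rate_ge0.
Qed.

Lemma rest_rateS i j s : (s < T)%N ->
  rest_rate i j s = edge_rate i j s + rest_rate i j s.+1.
Proof. by move=> sT; rewrite /rest_rate big_ltn. Qed.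

Lemma sum_pa_hit H i : wf_graph H ->
  \sum_(u < nvert H) pa_prob H u * (u == i :> nat)%:R = pa_prob H i :> R.
Proof.
move=> wH; case: (ltnP i (nvert H)) => iH.
  by rewrite (ev_indicator (fun b => b%:R) wH iH) add0r subr0 mulr1.
rewrite big1 => [|u _]; first by rewrite pa_probE // wf_degree_out // mul0r.
by rewrite ltn_eqF ?mulr0 // (leq_trans (ltn_ord u)).
Qed.

Lemma pa_prob_light H i : wf_graph H -> ~~ has_heavy p D H ->
  pa_prob H i <= D * (size (edges H))%:R `^ (c - 1) / lateness i / 2.
Proof.
move=> wH nh; have s0 : 0 < (size (edges H))%:R :> R by rewrite ltr0n wf_size_gt0.
rewrite pa_probE // ler_pdivrMr ?mulr_gt0 // (le_trans (light_degree i wH nh)) //.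
rewrite (@powRB _ _ c 1) ?(gt_eqF s0) ?implybT // powRr1 ?(ltW s0) //.
set y := _ `^ c; have f0 := lateness_gt0 i.
rewrite le_eqVlt; apply/orP; left; apply/eqP.
by field; rewrite !gt_eqF.
Qed.

Definition edge_hits i j (a : nat * nat) : bool :=
  ((a.1 == i) && (a.2 == j)) || ((a.1 == j) && (a.2 == i)).

Lemma sum_edge_hits H i j : wf_graph H -> ~~ has_heavy p D H ->
  \sum_(a : 'I_(nvert H) * 'I_(nvert H)) pa_prob H a.1 * pa_prob H a.2 *
     (edge_hits i j (a.1 : nat, a.2 : nat))%:R <=
  edge_rate i j (size (edges H)).
Proof.
move=> wH nh; have s0 : 0 < (size (edges H))%:R :> R by rewrite ltr0n wf_size_gt0.
have one (k l : nat) : \sum_(a : 'I_(nvert H) * 'I_(nvert H))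
    pa_prob H a.1 * pa_prob H a.2 * (((a.1 : nat) == k) && ((a.2 : nat) == l))%:R
    = pa_prob H k * pa_prob H l :> R.
  rewrite -(pair_big xpredT xpredT (fun u w : 'I_(nvert H) =>
    pa_prob H u * pa_prob H w * (((u : nat) == k) && ((w : nat) == l))%:R)) /=.
  rewrite -[X in X * _](sum_pa_hit k wH) mulr_suml; apply: eq_bigr => u _.
  rewrite -(sum_pa_hit l wH) mulr_sumr; apply: eq_bigr => w _.
  by case: eqP => _; case: eqP => _; rewrite /= ?mulr1 ?mulr0 ?mul0r.
apply: (@le_trans _ _ (pa_prob H i * pa_prob H j + pa_prob H j * pa_prob H i)).
  rewrite -!one -big_split /=; apply: ler_sum => a _; rewrite -mulrDr.
  rewrite ler_wpM2l ?mulr_ge0 ?pa_prob_ge0 // /edge_hits /=.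
  by case: (_ && _); case: (_ && _); rewrite //= ?addr0 ?add0r ?lerDl.
have hi := pa_prob_light i wH nh; have hj := pa_prob_light j wH nh.
rewrite [X in _ + X]mulrC.
have := ler_pM (pa_prob_ge0 R H i) (pa_prob_ge0 R H j) hi hj.
set s := (size _)%:R in s0 *; set y := s `^ (c - 1).
have -> : edge_rate i j (size (edges H)) =
    4 * (D * y / lateness i / 2 * (D * y / lateness j / 2)).
  rewrite /edge_rate -/s.
  have -> : s `^ (2 * c - 2) = y ^+ 2.
    by rewrite -powR_mulrn ?powR_ge0 // -powRrM; congr (_ `^ _); ring.
  by have fi := lateness_gt0 i; have fj := lateness_gt0 j; field; rewrite !gt_eqF.
set A := _ * _ / 2 * _; have A0 : 0 <= A.
  by rewrite /A !mulr_ge0 ?invr_ge0 ?powR_ge0 ?(ltW D0) ?(ltW (lateness_gt0 _)).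
by move: (pa_prob H i * _) => x; lra.
Qed.

Lemma adj_edge_step H u w i j :
  adj (edge_step H u w) i j = adj H i j || edge_hits i j (u, w).
Proof.
rewrite /adj /edge_hits /= !inE !xpair_eqE (eq_sym i u) (eq_sym j w).
by rewrite (eq_sym j u) (eq_sym i w) orbACA orbC.
Qed.

Lemma adj_vertex_step H u i j :
  adj (vertex_step H u) i j = adj H i j || edge_hits i j (nvert H, u).
Proof. exact: adj_edge_step. Qed.

Lemma adj_wf H i j : wf_graph H -> adj H i j -> (i < nvert H)%N && (j < nvert H)%N.
Proof.
by move=> wH /orP[] /(wf_ends wH) //=; rewrite andbC.
Qed.

Lemma edge_hits_excl i j k a : (i < j)%N -> (j < k)%N ->
  [&& ~~ (edge_hits i j a && edge_hits i k a),
      ~~ (edge_hits i j a && edge_hits j k a) &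
      ~~ (edge_hits i k a && edge_hits j k a)].
Proof. by case: a => u w; rewrite /edge_hits /=; lia. Qed.

Definition pot3 i j k H := pair_pot i j H * pair_pot i k H * pair_pot j k H.

(** Each new edge joins at most one of the three pairs, so the potential of the
    triple behaves as if the three pairs were independent. *)
Lemma ev_edge_pot3 i j k H : (i < j)%N -> (j < k)%N -> wf_graph H ->
  ~~ has_heavy p D H -> (size (edges H) < T)%N ->
  ev_edge (pot3 i j k) H <= pot3 i j k H.
Proof.
move=> ij jk wH nh sT; rewrite /ev_edge pair_big /=.
pose x l m := (if (m < nvert H)%N then (adj H l m)%:R else birth_rate l m) +
  rest_rate l m (size (edges H)).+1.
have x0 l m : 0 <= x l m.
  by rewrite addr_ge0 ?rest_rate_ge0 //; case: ifP => // _; exact: birth_rate_ge0.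
have xq l m : pair_pot l m H = x l m + edge_rate l m (size (edges H)).
  by rewrite /pair_pot rest_rateS // (addrC (edge_rate _ _ _)) addrA.
rewrite [leRHS]/pot3 !xq.
apply: (expect_prod3
  (w := fun a : 'I_(nvert H) * 'I_(nvert H) => pa_prob H a.1 * pa_prob H a.2)
  (F := fun a : 'I_(nvert H) * 'I_(nvert H) => pot3 i j k (edge_step H a.1 a.2))
  (e1 := fun a => edge_hits i j (a.1 : nat, a.2 : nat))
  (e2 := fun a => edge_hits i k (a.1 : nat, a.2 : nat))
  (e3 := fun a => edge_hits j k (a.1 : nat, a.2 : nat))) => //.
- by move=> a; rewrite mulr_ge0 ?pa_prob_ge0.
- by rewrite -(pair_big xpredT xpredT (fun u w : 'I_(nvert H) =>
    pa_prob H u * pa_prob H w)) /= sum2_pa_prob.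
- exact: sum_edge_hits.
- exact: sum_edge_hits.
- exact: sum_edge_hits.
- by move=> a; exact: edge_hits_excl.
have up l m (a : 'I_(nvert H) * 'I_(nvert H)) :
    pair_pot l m (edge_step H a.1 a.2) <=
    x l m + (edge_hits l m (a.1 : nat, a.2 : nat))%:R.
  rewrite /pair_pot /x /= -addrA (addrC (rest_rate _ _ _)) addrA lerD2r.
  case: ifP => _; last by rewrite lerDl.
  rewrite adj_edge_step; case: (adj _ _ _); case: (edge_hits _ _ _);
    by rewrite /= ?addr0 ?add0r ?lerDl.
by move=> a; rewrite !ler_pM ?mulr_ge0 ?pair_pot_ge0.
Qed.

Lemma ev_vertex_pot3 i j k H : (i < j)%N -> (j < k)%N -> wf_graph H ->
  ~~ has_heavy p D H -> (size (edges H) < T)%N ->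
  ev_vertex (pot3 i j k) H <= pot3 i j k H.
Proof.
move=> ij jk wH nh sT; rewrite /ev_vertex; set n := nvert H.
pose x l m := (if n == m then 0 else
   if (m < n)%N then (adj H l m)%:R else birth_rate l m) +
  rest_rate l m (size (edges H)).+1.
pose q l m := if n == m then birth_rate l m else 0.
have x0 l m : 0 <= x l m.
  rewrite addr_ge0 ?rest_rate_ge0 //; do 2 case: ifP => // _.
  exact: birth_rate_ge0.
have q0' l m : 0 <= q l m by rewrite /q; case: ifP => // _; exact: birth_rate_ge0.
have xq l m : x l m + q l m <= pair_pot l m H.
  rewrite /pair_pot rest_rateS // /x /q addrAC addrA lerD2r -/n.
  case: (ltngtP m n) => _; rewrite ?addr0 ?add0r lerDl; exact: edge_rate_ge0.
have xq0 l m : 0 <= x l m + q l m by exact: addr_ge0.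
apply: (@le_trans _ _ ((x i j + q i j) * (x i k + q i k) * (x j k + q j k)));
  last by rewrite !ler_pM // mulr_ge0.
pose e l m (u : 'I_n) := (n == m) && ((u : nat) == l).
have he l m : (l < m)%N -> \sum_(u < n) pa_prob H u * (e l m u)%:R <= q l m.
  move=> lm; rewrite /e /q; case: eqP => [nm|_] /=; last by rewrite big1 // => u _; rewrite mulr0.
  rewrite sum_pa_hit // (le_trans (pa_prob_light l wH nh)) //.
  have s0 : 0 < (size (edges H))%:R :> R by rewrite ltr0n wf_size_gt0.
  have fl := lateness_gt0 l; have fm := lateness_gt0 m.
  rewrite /birth_rate invfM !mulrA ler_pdivlMr // mulrAC -!mulrA.
  rewrite ler_wpM2l ?(ltW D0) // [leLHS]mulrCA [leRHS]mulrC ler_wpM2l ?invr_ge0 ?(ltW fl) //.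
  (* vertex m is born after time s, where s is at least its index m *)
  have fms : lateness m / 2 <= (size (edges H))%:R `^ c.
    rewrite ler_pdivrMr // /lateness.
    apply: (@le_trans _ _ ((2 * (size (edges H))%:R) `^ c)).
      rewrite ge0_ler_powR ?(ltW c0) ?nnegrE ?mulr_ge0 // -natrM ler_nat -nm mul2n -addnn.
      by rewrite -addn1 leq_add ?wf_nvert_le ?wf_size_gt0.
    rewrite powRM // mulrC ler_wpM2l ?powR_ge0 //.
    by rewrite -[leRHS]powRr1 // ler_powR // ler1n.
  apply: (@le_trans _ _ ((size (edges H))%:R `^ (c - 1) * (size (edges H))%:R `^ c)).
    by rewrite ler_wpM2l ?powR_ge0 // mulrC.
  rewrite -powRD; last by rewrite (gt_eqF s0) implybT.
  have -> : c - 1 + c = 2 * c - 1 by ring.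
  by rewrite ge0_ler_powR ?nnegrE // ler_nat ltnW.
apply: (expect_prod3 (w := fun u : 'I_n => pa_prob H u)
  (F := fun u : 'I_n => pot3 i j k (vertex_step H u)) (e1 := e i j)
  (e2 := e i k) (e3 := e j k)) => //.
- by move=> u; exact: pa_prob_ge0.
- exact: sum_pa_prob.
- exact: he.
- by apply: he; exact: ltn_trans jk.
- exact: he.
- by move=> u; rewrite /e; lia.
have up l m (u : 'I_n) : (l < m)%N ->
    pair_pot l m (vertex_step H u) <= x l m + (e l m u)%:R :> R.
  move=> lm; rewrite /pair_pot /x /= -addrA (addrC (rest_rate _ _ _)) addrA lerD2r.
  rewrite adj_vertex_step /edge_hits /= -/n ltnS /e.
  have un := ltn_ord u; case: (ltngtP m n) => mn /=; last 2 first.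
  - by rewrite addr0.
  - have /negPf -> : ~~ adj H l m.
      by apply/negP => /(adj_wf wH); rewrite -/n mn ltnn andbF.
    rewrite add0r /=; have /negPf -> : ~~ ((n == l) && ((u : nat) == m)) by lia.
    by [].
  have /negPf -> : ~~ ((n == l) && ((u : nat) == m)) by lia.
  by rewrite /= orbF addr0.
by move=> u; rewrite !ler_pM ?mulr_ge0 ?pair_pot_ge0 ?up // (ltn_trans ij).
Qed.

Lemma step_pot3 i j k H : (i < j)%N -> (j < k)%N -> wf_graph H ->
  ~~ has_heavy p D H -> (size (edges H) < T)%N ->
  step p (pot3 i j k) H <= pot3 i j k H.
Proof.
move=> ij jk wH nh sT; have hv := ev_vertex_pot3 ij jk wH nh sT.
have he := ev_edge_pot3 ij jk wH nh sT.
apply: (@le_trans _ _ (p * pot3 i j k H + (1 - p) * pot3 i j k H)).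
  by rewrite lerD // ler_wpM2l // ltW.
by rewrite -mulrDl addrC subrK mul1r.
Qed.

Definition triangle_at i j k H := [&& adj H i j, adj H i k & adj H j k].

Lemma pair_pot_loop i j : (0 < T)%N -> (i < j)%N ->
  pair_pot i j loop_graph <=
  D ^+ 2 * (2 + ln T%:R) * T%:R `^ (2 * c - 1) / (lateness i * lateness j).
Proof.
move=> T0 ij; rewrite /pair_pot /= ltnS leqn0 gtn_eqF; last by case: j ij.
have F0 : 0 < lateness i * lateness j by rewrite mulr_gt0.
rewrite /birth_rate /rest_rate /edge_rate -mulr_suml -mulrDl.
rewrite ler_wpM2r ?invr_ge0 ?(ltW F0) // -mulr_sumr.
have T0R : 0 < T%:R :> R by rewrite ltr0n.
set y := T%:R `^ (2 * c - 1); have y0 : 0 <= y by exact: powR_ge0.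
have hsum : \sum_(1 <= u < T) (u%:R : R) `^ (2 * c - 2) <= y * (1 + ln T%:R).
  apply: (@le_trans _ _ (\sum_(1 <= u < T) y * u%:R^-1)).
    rewrite big_nat_cond [leRHS]big_nat_cond; apply: ler_sum => u.
    rewrite andbT => /andP[u0 uT]; have uR : 0 < u%:R :> R by rewrite ltr0n.
    have -> : 2 * c - 2 = 2 * c - 1 - 1 by ring.
    rewrite (@powRB _ _ (2 * c - 1) 1) ?(gt_eqF uR) ?implybT // powRr1 //.
    rewrite ler_wpM2r ?invr_ge0 // ge0_ler_powR ?nnegrE //.
    by rewrite ler_nat ltnW.
  rewrite -mulr_sumr ler_wpM2l //.
  case: T T0 => // t _; apply: le_trans (harmonic_le R t).
  by rewrite [leRHS]big_nat_recr //= lerDl invr_ge0.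
have DD : D * y <= D ^+ 2 * y.
  by rewrite ler_wpM2r // expr2 ler_peMl // ltW.
have := ler_wpM2l (exprn_ge0 2 (ltW D0)) hsum.
rewrite mulrAC; set S := \sum_(_ <= _ < _) _; move: (D ^+ 2) DD => D2.
by move=> DD; rewrite -mulrA; lra.
Qed.

End Triangles.

Lemma card3_ord n (S : {set 'I_n}) : #|S| = 3%N ->
  exists i j k : 'I_n, [/\ (i < j)%N, (j < k)%N & S = [set i; j; k]%SET].
Proof.
move=> S3; have : sorted (relpre val ltn) (enum S).
  rewrite {1}/enum_mem -enumT sorted_filter //; first by move=> ? ? ?; exact: ltn_trans.
  by rewrite -sorted_map val_enum_ord iota_ltn_sorted.
have := mem_enum S; move: S3; rewrite cardE.
case: (enum S) => [|i [|j [|k []]]] //= _ memS /and3P[ij jk _].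
exists i, j, k; split => //; apply/setP => x; rewrite -memS !inE.
by rewrite orbA.
Qed.

Lemma num_triangles_le H N : (nvert H <= N)%N ->
  (num_triangles H <= \sum_(a : 'I_N * 'I_N * 'I_N | (a.1.1 < a.1.2 < a.2)%N)
     triangle_at a.1.1 a.1.2 a.2 H)%N.
Proof.
move=> nN.
pose w : 'I_(nvert H) -> 'I_N := widen_ord nN.
pose f (a : 'I_N * 'I_N * 'I_N) : {set 'I_N} := [set a.1.1; a.1.2; a.2]%SET.
pose A : {set 'I_N * 'I_N * 'I_N} :=
  [set a : 'I_N * 'I_N * 'I_N |
     (a.1.1 < a.1.2 < a.2)%N && triangle_at a.1.1 a.1.2 a.2 H]%SET.
apply: (@leq_trans #|A|); last first.
  rewrite -sum1_card big_mkcond [leqRHS]big_mkcond; apply: leq_sum => a _.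
  by rewrite inE; case: ifP => [/andP[-> ->]|] //; case: ifP.
apply: leq_trans (leq_imset_card f A); rewrite /num_triangles.
pose W (S : {set 'I_(nvert H)}) : {set 'I_N} := (w @: S)%SET.
have Winj : injective W by apply: imset_inj => x y /(congr1 val) /= /val_inj.
rewrite -(card_imset _ Winj); apply/subset_leq_card/fintype.subsetP => _ /imsetP[S + ->].
rewrite inE => /andP[/eqP /card3_ord[i [j [k [ij jk SE]]]] /forallP cl].
have adjS x y : x \in S -> y \in S -> x != y -> adj H x y.
  move=> xS yS xy; have := cl x; rewrite xS /= => /forallP /(_ y).
  by rewrite yS /= xy.
apply/imsetP; exists (w i, w j, w k); last first.
  by rewrite /W /f SE !imsetU !imset_set1.
rewrite inE /= ij jk /=; apply/and3P; split; apply: adjS; rewrite ?SE ?inE ?eqxx ?orbT //.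
- by rewrite -val_eqE ltn_eqF.
- by rewrite -val_eqE ltn_eqF // (ltn_trans ij).
- by rewrite -val_eqE ltn_eqF.
Qed.

Section TriangleBound.
Variables (R : realType) (p : R).
Hypothesis p01 : 0 < p < 1.

Let c : R := 1 - p / 2.
Let c0 : 0 < c. Proof. by case/andP: p01 => *; rewrite /c; lra. Qed.
Let c2 : 0 < 2 * c - 1. Proof. by case/andP: p01 => *; rewrite /c; lra. Qed.

(** Vertices [i] and [j] become likely to be joined by time [T] when
    [i * j] is below [T `^ (2 * clique_exp)]. *)
Definition clique_exp : R := (1 - p) / (2 - p).

Lemma powR_nat_inv (x : R) n : 0 <= x -> (x ^+ n)^-1 = x `^ (- n%:R).
Proof. by move=> x0; rewrite powRN powR_mulrn. Qed.

(** Being a probability, the left-hand side is at most the power [1 / (2 c)] of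
    any upper bound. Raised to this power the three factors
    [T `^ (2 c - 1) / ((i + 1) (j + 1)) `^ c] multiply to
    [T `^ (3 clique_exp) / ((i + 1) (j + 1) (k + 1))], whose sum over all triples
    has the right order. *)
Lemma Ex_triangle_at D i j k n : 1 <= D -> (i < j)%N -> (j < k)%N ->
  Ex p n (fun H => (triangle_at i j k H)%:R) loop_graph <=
  (D ^+ 2 * (2 + ln n.+1%:R)) ^+ 3 * n.+1%:R `^ (3 * clique_exp) *
   (i.+1%:R^-1 * j.+1%:R^-1 * k.+1%:R^-1) +
  \sum_(m < n) Ex p m (fun H => (has_heavy p D H)%:R) loop_graph.
Proof.
move=> D1 ij jk; set leak := \sum_(m < n) _.
have ik := ltn_trans ij jk.
have leak0 : 0 <= leak by rewrite sumr_ge0 // => m _; exact: Ex_ge0.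
have D0 : 0 < D by exact: lt_le_trans D1.
set E := Ex p n _ _; pose Phi := pot3 p D n.+1 i j k.
have E1 : E <= 1.
  rewrite -[leRHS](Ex_cst p01 n 1 wf_loop_graph); apply: (Ex_le p01 n step_closed_wf) => //.
    by move=> H _; case: triangle_at.
  exact: wf_loop_graph.
have Phi0 H : 0 <= Phi H by rewrite !mulr_ge0 ?pair_pot_ge0.
have hE : E <= Phi loop_graph + leak.
  apply: (Ex_super_leak p01 (S := wf_graph) (T := n.+1)) => //.
  - exact: step_closed_wf.
  - move=> H wH; case: (boolP (triangle_at i j k H)) => [|_]; last exact: Phi0.
    move=> /and3P[aij aik ajk]; have /andP[_ jH] := adj_wf wH aij.
    have /andP[_ kH] := adj_wf wH aik.
    rewrite /Phi /pot3 /pair_pot jH kH aij aik ajk.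
    by rewrite -[leLHS]mulr1 -[X in X * _]mulr1 !ler_pM // lerDl rest_rate_ge0.
  - by move=> H _; case: triangle_at.
  - move=> H wH hT; case: (boolP (has_heavy p D H)) => hh; [by right|left].
    exact: step_pot3.
  - exact: wf_loop_graph.
pose th : R := (2 * c)^-1; have c2p : 0 < 2 * c by rewrite mulr_gt0.
  have th0 : 0 < th by rewrite invr_gt0.
have th1 : th <= 1 by rewrite invf_le1 //; move: c2; rewrite subr_gt0; exact: ltW.
have hth : E <= Phi loop_graph `^ th + leak.
  have [le1|gt1] := leP (Phi loop_graph) 1.
    apply: (le_trans hE); rewrite lerD2r.
    have [->|n0] := eqVneq (Phi loop_graph) 0; first exact: powR_ge0.
    by rewrite ger1_powR // lt_neqAle eq_sym n0 Phi0.
  apply: (le_trans E1); rewrite -[leLHS]addr0 lerD //.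
  by rewrite -(powRr0 (Phi loop_graph)) ler_powR // ltW.
apply: (le_trans hth); rewrite lerD2r.
pose x (l : nat) : R := l.+1%:R `^ c.
have x0 l : 0 < x l by exact: powR_gt0.
pose y : R := n.+1%:R `^ (2 * c - 1).
have y0 : 0 <= y by exact: powR_ge0.
set be := D ^+ 2 * _; have be1 : 1 <= be.
  rewrite -[leLHS]mulr1 ler_pM ?exprn_ege1 //.
  have := ln_ge0 (_ : 1 <= n.+1%:R :> R); rewrite ler1n => /(_ isT); lra.
have be0 : 0 <= be by exact: le_trans be1.
have hPhi : Phi loop_graph <= (be * y) ^+ 3 * ((x i * x j * x k) ^+ 2)^-1.
  have := pair_pot_loop p01 D1 (ltn0Sn n) ij.
  have := pair_pot_loop p01 D1 (ltn0Sn n) ik.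
  have := pair_pot_loop p01 D1 (ltn0Sn n) jk.
  rewrite -/be -/c -/y -/(x i) -/(x j) -/(x k) => h1 h2 h3.
  apply: (@le_trans _ _ ((be * y / (x i * x j)) * (be * y / (x i * x k)) *
    (be * y / (x j * x k)))).
    by rewrite /Phi /pot3 !ler_pM ?mulr_ge0 ?pair_pot_ge0.
  have := x0 i; have := x0 j; have := x0 k.
  move: (x i) (x j) (x k) => a b d d0 b0 a0.
  by rewrite le_eqVlt; apply/orP; left; apply/eqP; field; rewrite !gt_eqF.
have rhs0 : 0 <= (be * y) ^+ 3 * ((x i * x j * x k) ^+ 2)^-1.
  exact: le_trans (Phi0 _) hPhi.
apply: (@le_trans _ _ (((be * y) ^+ 3 * ((x i * x j * x k) ^+ 2)^-1) `^ th)).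
  by rewrite ge0_ler_powR // ?nnegrE // ltW.
have X0 : 0 < x i * x j * x k by rewrite !mulr_gt0.
have bey0 : 0 <= be * y by exact: mulr_ge0.
rewrite powRM ?exprn_ge0 ?invr_ge0 ?exprn_ge0 ?(ltW X0) //.
apply: ler_pM; rewrite ?powR_ge0 //.
  rewrite exprMn powRM ?exprn_ge0 //; apply: ler_pM; rewrite ?powR_ge0 //.
    rewrite -powR_mulrn // -powRrM ler_powR // ler_piMr //; lra.
  rewrite /y -powR_mulrn ?powR_ge0 // -!powRrM.
  rewrite (_ : (2 * c - 1) * (3%:R * th) = 3 * clique_exp) // /th /clique_exp /c.
  by case/andP: p01 => *; field; lra.
rewrite powR_nat_inv ?(ltW X0) // -powRrM.
have xE l : x l `^ (- 2%:R * th) = l.+1%:R^-1.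
  rewrite /x -powRrM (_ : c * _ = -1); first by rewrite powR_inv1.
  by rewrite /th; field; lra.
rewrite powRM ?mulr_ge0 ?(ltW (x0 _)) // powRM ?(ltW (x0 _)) //.
by rewrite !xE.
Qed.

Lemma Ex_num_triangles D n : 1 <= D ->
  Ex p n (fun H => (num_triangles H)%:R) loop_graph <=
  (D ^+ 2 * (2 + ln n.+1%:R)) ^+ 3 * n.+1%:R `^ (3 * clique_exp) *
   (1 + ln n.+1%:R) ^+ 3 +
  n.+1%:R ^+ 3 *
  \sum_(m < n) Ex p m (fun H => (has_heavy p D H)%:R) loop_graph.
Proof.
move=> D1; set leak := \sum_(m < n) _.
have leak0 : 0 <= leak by rewrite sumr_ge0 // => m _; exact: Ex_ge0.
pose N := n.+1; set A := _ ^+ 3 * _ `^ _.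
have A0 : 0 <= A.
  rewrite mulr_ge0 ?powR_ge0 // exprn_ge0 // mulr_ge0 ?sqr_ge0 // addr_ge0 //.
  by rewrite ln_ge0 // ler1n.
apply: (@le_trans _ _ (Ex p n (fun H =>
   \sum_(a : 'I_N * 'I_N * 'I_N | (a.1.1 < a.1.2 < a.2)%N)
     (triangle_at a.1.1 a.1.2 a.2 H)%:R) loop_graph)).
  apply: (Ex_le_size p01 step_closed_wf); first exact: wf_loop_graph.
  move=> H wH; rewrite /= add1n => hs; rewrite -natr_sum ler_nat.
  by apply: num_triangles_le; rewrite /N -hs wf_nvert_le.
rewrite (Ex_sum p01) //; last exact: wf_loop_graph.
pose h l : R := l.+1%:R^-1.
apply: (@le_trans _ _ (\sum_(a : 'I_N * 'I_N * 'I_N)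
   (A * (h a.1.1 * h a.1.2 * h a.2) + leak))).
  apply: (@le_trans _ _ (\sum_(a : 'I_N * 'I_N * 'I_N | (a.1.1 < a.1.2 < a.2)%N)
   (A * (h a.1.1 * h a.1.2 * h a.2) + leak))).
    by apply: ler_sum => a /andP[ij jk]; exact: Ex_triangle_at.
  rewrite big_mkcond; apply: ler_sum => a _; case: ifP => // _.
  by rewrite addr_ge0 // mulr_ge0 // !mulr_ge0 ?invr_ge0.
rewrite big_split /= sumr_const !card_prod !card_ord -mulr_sumr.
rewrite -[leak *+ _]mulr_natl lerD //; last by rewrite !natrM !exprS expr0 mulr1 mulrA.
rewrite ler_wpM2l //.
have hs : \sum_(l < N) h l <= 1 + ln n.+1%:R.
  apply: le_trans (harmonic_le R n).
  by rewrite big_add1 /= big_mkord.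
have hs0 : 0 <= \sum_(l < N) h l by rewrite sumr_ge0 // => l _; rewrite invr_ge0.
rewrite -(pair_big xpredT xpredT (fun (u : 'I_N * 'I_N) (w : 'I_N) => h u.1 * h u.2 * h w)) /=.
under eq_bigr do rewrite -mulr_sumr.
rewrite -mulr_suml -(pair_big xpredT xpredT (fun u w : 'I_N => h u * h w)) /=.
under eq_bigr do rewrite -mulr_sumr.
by rewrite -mulr_suml !exprS expr0 mulr1 mulrA !ler_pM ?mulr_ge0.
Qed.

End TriangleBound.

(** * Paths of length two *)

Definition incid (v : nat) (e : nat * nat) : nat := ((e.1 == v) + (e.2 == v))%N.

Lemma degree_incid H v :
  degree H v = (\sum_(a < size (edges H)) incid v (nth (0, 0)%N (edges H) a))%N.
Proof. by rewrite /degree (big_nth (0, 0)%N) big_mkord. Qed.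

Lemma path2_common n e f : (e.1 < n)%N -> (e.2 < n)%N -> is_path2 e f ->
  (1 <= \sum_(v < n) incid v e * incid v f)%N.
Proof.
move=> e1 e2 /and3P[ne nf /eqP sz].
have [v [vn ve vf]] : exists v, [/\ (v < n)%N, (0 < incid v e)%N & (0 < incid v f)%N].
  case: e f e1 e2 ne nf sz => [a b] [x y] /= an bn ab xy.
  rewrite /incid /= !inE.
  have [ax|ax] := eqVneq a x; first by exists a; rewrite -ax !eqxx an.
  have [ay|ay] := eqVneq a y; first by exists a; rewrite -ay !eqxx an addn1.
  have [bx|bx] := eqVneq b x; first by exists b; rewrite -bx !eqxx bn addn1.
  have [by_|by_] := eqVneq b y; first by exists b; rewrite -by_ !eqxx bn !addn1.
  by rewrite (negPf ab) (negPf xy).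
by rewrite (bigD1 (Ordinal vn)) //= (leq_trans _ (leq_addr _ _)) // muln_gt0 ve.
Qed.

(** Two edges forming a path have a common endpoint [v], and [degree H v ^ 2]
    counts the ordered pairs of half-edges at [v]. *)
Lemma num_paths2_le H : wf_graph H ->
  (num_paths2 H <= \sum_(v < nvert H) degree H v ^ 2)%N.
Proof.
move=> wH; pose m := size (edges H); pose e a := nth (0, 0)%N (edges H) a.
apply: (@leq_trans (\sum_(a : 'I_m * 'I_m)
    \sum_(v < nvert H) incid v (e a.1) * incid v (e a.2))%N).
  rewrite /num_paths2 -sum1_card big_mkcond; apply: leq_sum => a _.
  rewrite inE; case: ifP => // /andP[_ pa].
  by apply: path2_common => //; have /andP[] := wf_ends wH (mem_nth (0, 0)%N (ltn_ord a.1)).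
rewrite exchange_big /=; apply: leq_sum => v _.
rewrite -(pair_big xpredT xpredT (fun u w : 'I_m => incid v (e u) * incid v (e w))%N) /=.
under eq_bigr do rewrite -big_distrr /=.
by rewrite -big_distrl /= -degree_incid expnS expn1.
Qed.

(** Vertex 0 serves as a hub. Repetitions are dropped because parallel edges do
    not form a path. *)
Definition spokes (H : mgraph) : seq (nat * nat) :=
  undup [seq e <- edges H | (e.2 == 0%N) && (e.1 != 0%N)].

(** Any two different spokes form a path, centred at vertex 0. *)
Lemma spokes_paths2 H :
  (size (spokes H) ^ 2 <= 2 * num_paths2 H + size (spokes H))%N.
Proof.
pose m := size (edges H); pose e a := nth (0, 0)%N (edges H) a.
set L := spokes H; set N := size L.
have memL x : x \in L -> [/\ x \in edges H, x.2 = 0%N & x.1 != 0%N].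
  by rewrite mem_undup mem_filter => /andP[/andP[/eqP ? ?] ?].
have fP (i : 'I_N) : (index (nth (0, 0)%N L i) (edges H) < m)%N.
  by rewrite index_mem; have [] := memL _ (mem_nth (0, 0)%N (ltn_ord i)).
pose f i := Ordinal (fP i).
have ef i : e (f i) = nth (0, 0)%N L i.
  by rewrite /e /= nth_index //; have [] := memL _ (mem_nth (0, 0)%N (ltn_ord i)).
have finj : injective f.
  move=> i j /(congr1 (fun x : 'I_m => e x)) /eqP; rewrite !ef nth_uniq ?undup_uniq //.
  by move=> /eqP /val_inj.
have path_f i j : i != j -> is_path2 (e (f i)) (e (f j)).
  move=> ij; have : e (f i) != e (f j) by rewrite !ef nth_uniq ?undup_uniq.
  rewrite !ef; have [_ e1 e2] := memL _ (mem_nth (0, 0)%N (ltn_ord i)).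
  have [_ g1 g2] := memL _ (mem_nth (0, 0)%N (ltn_ord j)).
  move: (nth _ L i) (nth _ L j) e1 e2 g1 g2 => [a b] [x y] /= -> a0 -> x0.
  rewrite xpair_eqE eqxx andbT /is_path2 /= a0 x0 !inE /= => ax.
  by rewrite (negPf a0) (negPf ax) (negPf x0) ?(eq_sym 0%N) ?(negPf x0) ?eqxx ?orbT.
pose P := [set ij : 'I_m * 'I_m |
   (ij.1 < ij.2)%N && is_path2 (e ij.1) (e ij.2)]%SET.
rewrite -[num_paths2 H]/#|P|.
pose lt := [set a : 'I_N * 'I_N | (f a.1 < f a.2)%N]%SET.
pose gt := [set a : 'I_N * 'I_N | (f a.2 < f a.1)%N]%SET.
pose dg := [set a : 'I_N * 'I_N | a.1 == a.2]%SET.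
have fne i j : (f i < f j)%N -> i != j.
  by apply: contraTneq => ->; rewrite ltnn.
have lP : (#|lt| <= #|P|)%N.
  have inj : injective (fun a : 'I_N * 'I_N => (f a.1, f a.2)).
    move=> [a b] [x y] E.
    by have /= -> := finj _ _ (congr1 fst E); have /= -> := finj _ _ (congr1 snd E).
  rewrite -(card_imset _ inj); apply/subset_leq_card/fintype.subsetP => _ /imsetP[a + ->].
  by rewrite !inE => al /=; rewrite al path_f // fne.
have gP : (#|gt| <= #|P|)%N.
  have inj : injective (fun a : 'I_N * 'I_N => (f a.2, f a.1)).
    move=> [a b] [x y] E.
    by have /= -> := finj _ _ (congr1 snd E); have /= -> := finj _ _ (congr1 fst E).
  rewrite -(card_imset _ inj); apply/subset_leq_card/fintype.subsetP => _ /imsetP[a + ->].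
  by rewrite !inE => al /=; rewrite al path_f // fne.
have dN : (#|dg| <= N)%N.
  have inj : injective (fun i : 'I_N => (i, i)) by move=> i j [].
  rewrite -[leqRHS]card_ord -cardsT -(card_imset _ inj).
  apply/subset_leq_card/fintype.subsetP => [[i j]]; rewrite inE /= => /eqP ->.
  by apply/imsetP; exists j.
have cov : (#|[set: 'I_N * 'I_N]%SET| <= #|lt :|: gt :|: dg|)%N.
  apply/subset_leq_card/fintype.subsetP => [[i j]] _; rewrite !inE /=.
  case: ltngtP => //= ij; apply/eqP/finj/val_inj; exact: ij.
move: cov; rewrite cardsT card_prod card_ord => cov.
have c1 : (#|lt :|: gt :|: dg| <= #|lt :|: gt| + #|dg|)%N by rewrite cardsU leq_subr.
have c2 : (#|lt :|: gt| <= #|lt| + #|gt|)%N by rewrite cardsU leq_subr.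
rewrite expnS expn1; lia.
Qed.

Lemma spokes_le_edge H u w :
  (size (spokes H) <= size (spokes (edge_step H u w)))%N.
Proof.
rewrite /spokes /=; case: ifP => // _ /=; case: ifP => //= _; exact: leqnSn.
Qed.

Lemma spokes_vertex H u : wf_graph H ->
  size (spokes (vertex_step H u)) = ((u == 0)%N + size (spokes H))%N.
Proof.
move=> wH; rewrite /spokes /= -[(nvert H == 0)%N]negbK -lt0n wf_nvert_gt0 // andbT.
case: ifP => // u0 /=; rewrite mem_filter; case: ifP => // /andP[_ /(wf_ends wH)].
by rewrite /= ltnn.
Qed.

(** * Events that become unlikely at an exponential rate *)

Section Decay.
Variables (R : realType) (p : R).
Hypothesis p01 : 0 < p < 1.

Let p0 : 0 < p. Proof. by case/andP: p01. Qed.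
Let q0 : 0 < 1 - p. Proof. by case/andP: p01; rewrite subr_gt0. Qed.

Lemma Ex_exp_decay S (F : mgraph -> R) (rho : R) T : step_closed S ->
  (forall H, S H -> wf_graph H) -> (forall H, 0 <= F H) ->
  (forall H, S H -> (size (edges H) < T)%N -> step p F H <= (1 - rho) * F H) ->
  forall n G, S G -> (size (edges G) + n <= T)%N ->
  Ex p n F G <= expR (- (rho * n%:R)) * F G.
Proof.
move=> cS Swf F0 h; elim=> [|n IH] G SG hT.
  by rewrite mulr0 oppr0 expR0 mul1r.
have [c1 c2] := cS G SG.
apply: (@le_trans _ _ (step p (fun H => expR (- (rho * n%:R)) * F H) G)).
  by apply: (step_le p01) => *; apply: IH => //=; rewrite ?addSnnS; auto.
have -> : rho * n.+1%:R = rho * n%:R + rho by rewrite -[n.+1]addn1 natrD; ring.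
rewrite (stepZ) opprD expRD -mulrA ler_wpM2l ?expR_ge0 //.
apply: (le_trans (h _ SG _)); first by rewrite (leq_trans _ hT) // -addSnnS leq_addr.
by rewrite ler_wpM2r // expR_ge1Dx.
Qed.

Lemma Ex_few_vertices n :
  Ex p n (fun H => (2^-1 : R) ^+ nvert H) loop_graph <= expR (- (p / 2 * n%:R)).
Proof.
have h := @Ex_exp_decay wf_graph (fun H => 2^-1 ^+ nvert H) (p / 2) n.+1 step_closed_wf.
apply: (le_trans (h _ _ _ n loop_graph wf_loop_graph _)) => //.
- move=> H wH _; rewrite /step /ev_vertex /ev_edge /=.
  rewrite -mulr_suml sum_pa_prob //; under eq_bigr do rewrite -mulr_suml.
  rewrite -mulr_suml sum2_pa_prob // exprS !mul1r.
  by set x := _ ^+ _; lra.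
- by rewrite /= expr1 ler_piMr ?expR_ge0 // invf_le1 // ler1n.
Qed.

Lemma pa_prob_ge H i (la : R) T : wf_graph H -> 0 <= la -> la <= (degree H i)%:R ->
  (size (edges H) < T)%N -> la / (2 * T%:R) <= pa_prob H i.
Proof.
move=> wH la0 hd hT; rewrite pa_probE // ler_pM ?invr_ge0 //.
rewrite lef_pV2 ?posrE ?mulr_gt0 ?ltr0n ?wf_size_gt0 ?(leq_ltn_trans _ hT) //.
by rewrite ler_pM2l // ler_nat ltnW.
Qed.

Lemma degree_ge_closed i (la : R) : step_closed (fun H => la <= (degree H i)%:R).
Proof.
move=> H hH; split=> [u _|u w _ _]; apply: (le_trans hH); rewrite ler_nat.
  by rewrite degree_vertex_step leq_addl.
by rewrite degree_edge_step leq_addl.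
Qed.

Lemma Ex_few_spokes n (la : R) G : wf_graph G -> 0 <= la ->
  la <= (degree G 0)%:R ->
  Ex p n (fun H => (2^-1 : R) ^+ size (spokes H)) G <=
  expR (- (p * la / (4 * (size (edges G) + n)%:R) * n%:R)).
Proof.
pose F H : R := 2^-1 ^+ size (spokes H).
move=> wG la0 hG; rewrite -[Ex _ _ _ _]/(Ex p n F G); set T := (size (edges G) + n)%N.
have h := @Ex_exp_decay (fun H => wf_graph H /\ la <= (degree H 0)%:R)
  F (p * la / (4 * T%:R)) T.
apply: (le_trans (h _ _ _ _ n G _ _)) => //.
- by apply: step_closedI; [exact: step_closed_wf|exact: degree_ge_closed].
- by move=> H [].
- by move=> H; rewrite /F exprn_ge0 // invr_ge0.
- move=> H [wH hH] hT; set N := size (spokes H).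
  have pi0 := pa_prob_ge wH la0 hH hT.
  have x0 : 0 <= 2^-1 ^+ N :> R by rewrite exprn_ge0 // invr_ge0.
  have EV : ev_vertex F H =
      2^-1 ^+ N * (1 - pa_prob H 0 / 2).
    rewrite /ev_vertex /F; pose g (b : bool) : R := 2^-1 ^+ (b + N).
    rewrite (eq_bigr (fun u : 'I_(nvert H) => pa_prob H u * g (u == 0 :> nat)%N)).
      rewrite (ev_indicator g wH (wf_nvert_gt0 wH)) /g add0n add1n exprS.
      by field.
    by move=> u _; rewrite spokes_vertex.
  have EE : ev_edge F H <= 2^-1 ^+ N.
    rewrite -[leRHS]mul1r -[X in _ <= X * _](sum2_pa_prob R wH) mulr_suml; apply: ler_sum => u _.
    rewrite mulr_suml; apply: ler_sum => w _; rewrite ler_wpM2l ?mulr_ge0 ?pa_prob_ge0 //.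
    by apply: ler_wiXn2l; rewrite ?invr_ge0 ?invf_le1 ?ler1n ?spokes_le_edge.
  rewrite /step EV; apply: (le_trans (lerD (lexx _) (ler_wpM2l (ltW q0) EE))).
  rewrite [p * (_ * _)]mulrCA [(1 - p) * _]mulrC -mulrDr mulrC ler_wpM2r //.
  have -> : p * la / (4 * T%:R) = p * (la / (2 * T%:R)) / 2.
    by rewrite -[4%:R]/((2 * 2)%:R) natrM !invfM; ring.
  have : p * (la / (2 * T%:R)) <= p * pa_prob H 0 by rewrite ler_wpM2l // ltW.
  by move: (p * (la / _)) => a; lra.
- by rewrite ler_piMr ?expR_ge0 // exprn_ile1 ?invr_ge0 // invf_le1 // ler1n.
Qed.

Lemma Ex_nonadj n i j (la : R) G : wf_graph G -> 0 <= la ->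
  la <= (degree G i)%:R -> la <= (degree G j)%:R ->
  (i < nvert G)%N -> (j < nvert G)%N ->
  Ex p n (fun H => (~~ adj H i j)%:R) G <=
  expR (- ((1 - p) * (la / (2 * (size (edges G) + n)%:R)) ^+ 2 * n%:R)).
Proof.
move=> wG la0 hi hj iG jG; set T := (size (edges G) + n)%N.
have h := @Ex_exp_decay (fun H => wf_graph H /\ (la <= (degree H i)%:R /\
   (la <= (degree H j)%:R /\ ((i < nvert H)%N /\ (j < nvert H)%N))))
  (fun H => (~~ adj H i j)%:R) ((1 - p) * (la / (2 * T%:R)) ^+ 2) T.
apply: (le_trans (h _ _ _ _ n G _ _)) => //.
- apply: step_closedI; first exact: step_closed_wf.
  do 2 (apply: step_closedI; first exact: degree_ge_closed).
  by apply: step_closedI => H iH; split=> //= u _; exact: ltnW.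
- by move=> H [].
- move=> H [wH [hiH [hjH [iH jH]]]] hT.
  have pi_i := pa_prob_ge wH la0 hiH hT; have pi_j := pa_prob_ge wH la0 hjH hT.
  set rho := (la / _) in pi_i pi_j *.
  have rho0 : 0 <= rho by rewrite divr_ge0 // mulr_ge0.
  have adjE u w : adj H i j -> adj (edge_step H u w) i j.
    by rewrite adj_edge_step => ->.
  case: (boolP (adj H i j)) => aij /=.
    rewrite mulr0 -[leRHS](step_cst p 0 wH).
    by apply: (step_le p01) => [u _|u w _ _]; rewrite ?adj_vertex_step ?adj_edge_step aij.
  have EV : ev_vertex (fun H => (~~ adj H i j)%:R) H <= 1 :> R.
    rewrite -[leRHS](sum_pa_prob R wH); apply: ler_sum => u _.
    by rewrite ler_piMr ?pa_prob_ge0 //; case: adj.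
  have EE : ev_edge (fun H => (~~ adj H i j)%:R) H <= 1 - pa_prob H i * pa_prob H j :> R.
    rewrite -[X in _ <= X - _](sum2_pa_prob R wH) lerBrDr -(sum_pa_hit R i wH) -(sum_pa_hit R j wH).
    rewrite mulr_suml /ev_edge -big_split /=; apply: ler_sum => u _.
    rewrite mulr_sumr -big_split /=; apply: ler_sum => w _.
    have -> : pa_prob H u * ((u : nat) == i)%:R * (pa_prob H w * ((w : nat) == j)%:R) =
      pa_prob H u * pa_prob H w * (((u : nat) == i) && ((w : nat) == j))%:R :> R.
      by rewrite -mulnb natrM; ring.
    rewrite -mulrDr ler_piMr ?mulr_ge0 ?pa_prob_ge0 //.
    rewrite adj_edge_step /edge_hits /=.
    by case: (_ && _); case: adj; case: (_ && _); rewrite /= ?addr0 ?add0r.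
  rewrite mulr1 /step; apply: (le_trans (lerD (ler_wpM2l (ltW p0) EV) (ler_wpM2l (ltW q0) EE))).
  have hr : rho ^+ 2 <= pa_prob H i * pa_prob H j by rewrite expr2 ler_pM.
  by have := ler_wpM2l (ltW q0) hr; lra.
- by rewrite ler_piMr ?expR_ge0 //; case: adj.
Qed.

End Decay.

(** * Bounds holding with high probability *)

Section HighProbability.
Variables (R : realType) (p : R).
Hypothesis p01 : 0 < p < 1.

Let p0 : 0 < p. Proof. by case/andP: p01. Qed.
Let p1 : p < 1. Proof. by case/andP: p01. Qed.
Let c : R := 1 - p / 2.
Let c0 : 0 < c. Proof. by rewrite /c; have := p1; lra. Qed.

Definition Pr (n : nat) (A : pred mgraph) : R :=
  Ex p n (fun H => (A H)%:R) loop_graph.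

Lemma Pr_ge0 n A : 0 <= Pr n A.
Proof. exact: Ex_ge0. Qed.

Lemma powR_near_ge (K eta : R) : 0 < eta ->
  \forall n \near \oo, K <= n.+1%:R `^ eta.
Proof.
move=> eta0; near=> n.
have hn : (Num.truncn (`|K| `^ eta^-1) <= n)%N by near: n; exact: nbhs_infty_ge.
have K0 : 0 <= `|K| by exact: normr_ge0.
apply: (le_trans (ler_norm K)).
have -> : `|K| = (`|K| `^ eta^-1) `^ eta.
  by rewrite -powRrM mulVf ?powRr1 // gt_eqF.
rewrite ge0_ler_powR ?nnegrE ?powR_ge0 ?(ltW eta0) //.
by rewrite (le_trans (ltW (truncnS_gt _))) // ler_nat ltnS.
Unshelve. all: by end_near. Qed.

Lemma unlikely_powR (A : nat -> pred mgraph) (K eta : R) : 0 < eta ->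
  (\forall n \near \oo, Pr n (A n) <= K * n.+1%:R `^ (- eta)) ->
  Pr n (A n) @[n --> \oo] --> (0 : R).
Proof.
move=> eta0 hA; apply/cvgrPdist_le => e e0; near=> n.
rewrite sub0r normrN ger0_norm ?Pr_ge0 //.
have t0 : 0 < n.+1%:R `^ eta :> R by rewrite powR_gt0.
apply: (@le_trans _ _ (K * n.+1%:R `^ (- eta))); first by near: n.
rewrite powRN ler_pdivrMr // mulrC -ler_pdivrMr //.
by near: n; exact: powR_near_ge.
Unshelve. all: by end_near. Qed.

Lemma Pr_markov n (A : pred mgraph) (F : mgraph -> R) (K : R) : 0 < K ->
  (forall H, wf_graph H -> 0 <= F H) ->
  (forall H, wf_graph H -> size (edges H) = n.+1 -> A H -> K <= F H) ->
  Pr n A <= Ex p n F loop_graph / K.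
Proof.
move=> K0 F0 hF; rewrite ler_pdivlMr // mulrC -(ExZ p01).
apply: (Ex_le_size p01 step_closed_wf); first exact: wf_loop_graph.
move=> H wH /=; rewrite add1n => hs.
by case: (boolP (A H)) => hA; rewrite ?mulr1 ?mulr0 ?hF ?F0.
Qed.

Lemma Pr_le n (A B : pred mgraph) :
  (forall H, wf_graph H -> size (edges H) = n.+1 -> A H -> B H) ->
  Pr n A <= Pr n B.
Proof.
move=> hAB; apply: (Ex_le_size p01 step_closed_wf); first exact: wf_loop_graph.
move=> H wH /=; rewrite add1n => hs.
by case: (boolP (A H)) => // /hAB ->.
Qed.

Lemma log_le_powR (d : R) : 0 < d -> forall n, 
  2 + ln n.+1%:R <= (2 + d^-1) * n.+1%:R `^ d :> R.
Proof.
move=> d0 n; have t0 : 0 < n.+1%:R `^ d :> R by rewrite powR_gt0.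
have t1 : 1 <= n.+1%:R `^ d :> R.
  by rewrite -[leLHS](powRr0 n.+1%:R) ler_powR ?(ltW d0) // ler1n.
have h : ln n.+1%:R <= d^-1 * n.+1%:R `^ d :> R.
  have := ltW (ln_sublinear t0); rewrite ln_powR => h.
  by rewrite mulrC ler_pdivlMr // mulrC.
by rewrite mulrDl lerD // ler_peMr.
Qed.

(** ** Upper bounds *)

(** With high moments of order [r], heavy vertices are so unlikely that even
    five powers of [n] do not make up for them. *)
Definition high_order (k : R) : nat := (Num.truncn (6 / k)).+1.

Let hcst k := heavy_cst p (high_order k).

Lemma Pr_has_heavy (k : R) n m : 0 < k -> (m <= n)%N ->
  Pr m (has_heavy p (n.+1%:R `^ k)) <= hcst k * n.+1%:R `^ (- 5).
Proof.
move=> k0 mn; have n0 : 0 < n.+1%:R :> R by [].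
have tk : 0 < n.+1%:R `^ k :> R by rewrite powR_gt0.
apply: (le_trans (Ex_has_heavy p01 m (high_order k) tk)).
rewrite mulrCA ler_wpM2l ?heavy_cst_ge0 //.
rewrite ler_pdivrMr ?exprn_gt0 // -powR_mulrn ?powR_ge0 // -powRrM -powRD; last first.
  by rewrite (gt_eqF n0) implybT.
apply: (@le_trans _ _ n.+1%:R); first by rewrite ler_nat ltnS.
rewrite -[leLHS](powRr1 (ler0n _ _)) ler_powR ?ler1n //.
have : 6 / k <= (high_order k)%:R by rewrite ltW // truncnS_gt.
by rewrite ler_pdivrMr // mulrC; lra.
Qed.

Lemma few_triangles (k : R) : 0 < k -> exists2 K, 0 < K &
  Pr n (fun H => K * n.+1%:R `^ (3 * clique_exp p + 13 * k) < (num_triangles H)%:R)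
    @[n --> \oo] --> (0 : R).
Proof.
move=> k0; exists 1 => //.
pose L := 2 + k^-1; have L0 : 0 < L by rewrite addr_gt0 ?invr_gt0.
apply: (@unlikely_powR _ (L ^+ 6 + hcst k) k k0); apply: nearW => n.
have n0 : 0 < n.+1%:R :> R by [].
have n1 : 1 <= n.+1%:R :> R by rewrite ler1n.
have tD x y : n.+1%:R `^ (x + y) = n.+1%:R `^ x * n.+1%:R `^ y :> R.
  by rewrite powRD // (gt_eqF n0) implybT.
pose t := n.+1%:R `^ k; have t0 : 0 < t by rewrite powR_gt0.
have t1 : 1 <= t by rewrite -[leLHS](powRr0 n.+1%:R) ler_powR // ltW.
have tn j : n.+1%:R `^ (j%:R * k) = t ^+ j :> R.
  by rewrite mulrC powRrM powR_mulrn // powR_ge0.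
have ln0 : 0 <= ln n.+1%:R :> R by rewrite ln_ge0.
have hlog : 2 + ln n.+1%:R <= L * t :> R by exact: log_le_powR.
have hlog1 : 1 + ln n.+1%:R <= L * t :> R.
  by apply: le_trans hlog; rewrite lerD2r ler1n.
set y := n.+1%:R `^ (3 * clique_exp p).
have y0 : 0 < y by rewrite powR_gt0.
have a0 : 0 <= 3 * clique_exp p.
  by rewrite mulr_ge0 // divr_ge0; have := p1; lra.
have y1 : 1 <= y by rewrite -[leLHS](powRr0 n.+1%:R) ler_powR.
apply: le_trans (Pr_markov (F := fun H => (num_triangles H)%:R)
   (K := y * t ^+ 13) _ _ _) _ => //.
- by rewrite mulr_gt0 ?exprn_gt0.
- by move=> H wH hs; rewrite mul1r tD (tn 13) => /ltW.
rewrite ler_pdivrMr ?mulr_gt0 ?exprn_gt0 //.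
apply: (le_trans (Ex_num_triangles p01 n t1)); rewrite -/y.
have -> : (L ^+ 6 + hcst k) * n.+1%:R `^ (- k) * (y * t ^+ 13) =
    (L * t) ^+ 3 * t ^+ 6 * y * (L * t) ^+ 3 + hcst k * (y * t ^+ 12).
  by rewrite powRN -/t; field; rewrite gt_eqF.
apply: lerD.
  have l2 : 0 <= 2 + ln n.+1%:R :> R by rewrite addr_ge0.
  have m0 : 0 <= (t ^+ 2 * (2 + ln n.+1%:R)) ^+ 3 * y.
    by rewrite mulr_ge0 ?(ltW y0) // exprn_ge0 // mulr_ge0 ?sqr_ge0.
  have m1 : 0 <= 1 + ln n.+1%:R :> R by rewrite addr_ge0.
  apply: ler_pM => //; first by rewrite exprn_ge0.
    rewrite ler_wpM2r ?(ltW y0) // exprMn -exprM mulrC ler_wpM2r ?exprn_ge0 ?(ltW t0) //.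
    by rewrite lerXn2r ?nnegrE // mulr_ge0 ?(ltW L0) ?(ltW t0).
  by rewrite lerXn2r ?nnegrE // mulr_ge0 ?(ltW L0) ?(ltW t0).
apply: (@le_trans _ _ (n.+1%:R ^+ 3 * \sum_(m < n) hcst k * n.+1%:R `^ (- 5))).
  rewrite ler_wpM2l ?exprn_ge0 //; apply: ler_sum => m _.
  by apply: Pr_has_heavy => //; exact: ltnW.
rewrite sumr_const card_ord -[X in _ * X <= _]mulr_natl.
have -> : n.+1%:R ^+ 3 * (n%:R * (hcst k * n.+1%:R `^ (- 5))) =
   hcst k * (n.+1%:R ^+ 3 * n%:R * n.+1%:R `^ (- 5)) by ring.
rewrite ler_wpM2l ?heavy_cst_ge0 //.
apply: (@le_trans _ _ 1); last first.
  by rewrite -[leLHS]mulr1 ler_pM // exprn_ege1.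
rewrite powR_invn // ler_pdivrMr ?exprn_gt0 // mul1r.
rewrite (exprD _ 3 2) ler_wpM2l ?exprn_ge0 //.
by rewrite (le_trans (_ : n%:R <= n.+1%:R)) ?ler_nat // expr2 ler_peMr.
Qed.

(** When no vertex is heavy, the squared degrees sum to at most
    [n `^ (2 c + 2 k) * \sum_i i `^ (- 2 c)], and [2 c = 2 - p > 1]. *)
Lemma few_paths2 (k : R) : 0 < k -> exists2 K, 0 < K &
  Pr n (fun H => K * n.+1%:R `^ (2 - p + 3 * k) < (num_paths2 H)%:R)
    @[n --> \oo] --> (0 : R).
Proof.
move=> k0; pose L := 2 + k^-1; have L0 : 0 < L by rewrite addr_gt0 ?invr_gt0.
exists L => //.
have h5 : 0 < 5 :> R by [].
apply: (@unlikely_powR _ (hcst k) 5 h5); apply: nearW => n.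
apply: le_trans (Pr_has_heavy k0 (leqnn n)); apply: Pr_le => H wH hs.
apply: contraTT => nh; rewrite -leNgt.
have n0 : 0 < n.+1%:R :> R by [].
have n1 : 1 <= n.+1%:R :> R by rewrite ler1n.
pose t := n.+1%:R `^ k; have t0 : 0 < t by rewrite powR_gt0.
have t1 : 1 <= t by rewrite -[leLHS](powRr0 n.+1%:R) ler_powR // ltW.
have := num_paths2_le wH; rewrite -(ler_nat R) => /le_trans; apply.
rewrite natr_sum.
pose y := n.+1%:R `^ (2 - p); have y0 : 0 <= y by exact: powR_ge0.
have hv (v : 'I_(nvert H)) : (degree H v ^ 2)%:R <= t ^+ 2 * y * v.+1%:R^-1.
  rewrite natrX; apply: (@le_trans _ _ ((t * n.+1%:R `^ c / v.+1%:R `^ c) ^+ 2)).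
    rewrite lerXn2r ?nnegrE ?mulr_ge0 ?invr_ge0 ?powR_ge0 ?(ltW t0) //.
    by have := light_degree t1 v wH nh; rewrite hs.
  rewrite exprMn exprMn exprVn -!(powR_mulrn 2) ?powR_ge0 // -!powRrM.
  have -> : c * 2%:R = 2 - p by rewrite /c; field.
  rewrite -/y ler_wpM2l ?mulr_ge0 ?powR_ge0 //.
  rewrite lef_pV2 ?posrE ?powR_gt0 // -[leLHS](powRr1 (ler0n _ _)) ler_powR ?ler1n //.
  by have := p1; lra.
apply: (le_trans (ler_sum _ (fun v _ => hv v))); rewrite -mulr_sumr.
have -> : L * n.+1%:R `^ (2 - p + 3 * k) = t ^+ 2 * y * (L * t).
  rewrite powRD; last by rewrite (gt_eqF n0) implybT.
  have -> : n.+1%:R `^ (3 * k) = t ^+ 3 by rewrite mulrC powRrM powR_mulrn ?powR_ge0.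
  by rewrite -/y; ring.
rewrite ler_wpM2l ?mulr_ge0 ?exprn_ge0 ?(ltW t0) //.
apply: le_trans (log_le_powR k0 n); apply: (@le_trans _ _ (1 + ln n.+1%:R)); last first.
  by rewrite lerD2r; lra.
apply: le_trans (harmonic_le R n); rewrite big_add1 /= big_mkord.
have := wf_nvert_le wH; rewrite hs => nn.
rewrite (big_ord_widen _ (fun v => v.+1%:R^-1) nn) big_mkcond; apply: ler_sum => v _.
by case: ifP => // _; rewrite invr_ge0.
Qed.

End HighProbability.

(** * Many paths of length two *)

Lemma sqr_le_double N P : (2 <= N)%N -> (N ^ 2 <= 2 * P + N)%N ->
  (N ^ 2 <= 4 * P)%N.
Proof.
move=> N2; have : (N * 2 <= N * N)%N by rewrite leq_mul2l N2 orbT.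
by rewrite -mulnn; move: (N * N)%N => a; lia.
Qed.

Section Elementary.
Variable R : realType.

Lemma expRN_le (x : R) : 0 < x -> expR (- x) <= x^-1.
Proof.
move=> x0; rewrite expRN lef_pV2 ?posrE ?expR_gt0 //.
by apply: le_trans (expR_ge1Dx x); rewrite lerDr.
Qed.

Lemma half_pow_ge (N : nat) (y : R) : N%:R <= y -> 1 <= expR y * 2^-1 ^+ N.
Proof.
move=> hN; rewrite exprVn ler_pdivlMr ?exprn_gt0 // mul1r.
apply: (@le_trans _ _ (expR N%:R)); last by rewrite ler_expR.
rewrite -[N%:R]mulr1 expRM_natl lerXn2r ?nnegrE ?expR_ge0 //.
by have := expR_ge1Dx (1 : R).
Qed.

Lemma quarter_le_half (n : nat) : (3 <= n)%N -> n.+1%:R / 4 <= n./2%:R :> R.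
Proof.
move=> n3; rewrite ler_pdivrMr // -natrM ler_nat.
have := odd_double_half n; rewrite -muln2; lia.
Qed.

Lemma half_le_uphalf (n : nat) : n.+1%:R / 2 <= (n - n./2).+1%:R :> R.
Proof.
rewrite ler_pdivrMr // -natrM ler_nat.
have := odd_double_half n; rewrite -muln2; lia.
Qed.

End Elementary.

Section LowerBounds.
Variables (R : realType) (p : R).
Hypothesis p01 : 0 < p < 1.

Let p0 : 0 < p. Proof. by case/andP: p01. Qed.
Let p1 : p < 1. Proof. by case/andP: p01. Qed.
Let c : R := 1 - p / 2.
Let c0 : 0 < c. Proof. by rewrite /c; have := p1; lra. Qed.
Let c1 : c <= 1. Proof. by rewrite /c; have := p0; lra. Qed.

(** Vertex 0 has degree of order [n `^ c] at half time, and afterwards new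
    vertices attach to it at a steady rate: any two of these edges form a path. *)
Lemma many_paths2 (k : R) : 0 < k -> k <= 4^-1 -> exists2 K, 0 < K &
  Pr p n (fun H => (num_paths2 H)%:R < K * n.+1%:R `^ (2 - p - 2 * k))
    @[n --> \oo] --> (0 : R).
Proof.
move=> k0 k4; exists ((p / 128) ^+ 2); first by rewrite exprn_gt0 // divr_gt0.
pose C := 2 * expR (rate p (- 2^-1)).
have C0 : 0 < C by rewrite mulr_gt0 ?expR_gt0.
have k20 : 0 < k / 2 by rewrite divr_gt0.
have ck2 : k / 2 <= c - k by rewrite /c; have := p1; lra.
have ck : 0 < c - k by exact: lt_le_trans ck2.
apply: (@unlikely_powR _ _ p01 _ (C + 64 / p) (k / 2)) => //.
near=> n.
have n3 : (3 <= n)%N by near: n; exact: nbhs_infty_ge.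
have n0 : 0 < n.+1%:R :> R by [].
have n1 : 1 <= n.+1%:R :> R by rewrite ler1n.
have tD x y : n.+1%:R `^ (x + y) = n.+1%:R `^ x * n.+1%:R `^ y :> R.
  by rewrite powRD // (gt_eqF n0) implybT.
(* la is a degree slightly below the typical one, and y a fraction of the number
   of spokes expected from a hub of this degree *)
pose la : R := n.+1%:R `^ (c - k) / 2; pose y := p * la / 32.
have la0 : 0 < la by rewrite divr_gt0 // powR_gt0.
have y0 : 0 < y by rewrite divr_gt0 // mulr_gt0.
have y2 : 2 <= y.
  rewrite /y /la.
  have : 128 / p <= n.+1%:R `^ (c - k) by near: n; exact: powR_near_ge.
  by rewrite ler_pdivrMr //; move: (_ `^ _) => z; lra.
pose B H := (size (spokes H))%:R <= y.
apply: (@le_trans _ _ (Pr p n B)).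
  apply: (Pr_le p01) => H wH _; apply: contraTT; rewrite /B -ltNge -leNgt => hN.
  have := spokes_paths2 H; set N := size _ in hN *; move=> hP.
  have N2 : (2 <= N)%N by rewrite -(ler_nat R) (le_trans y2) // ltW.
  have hP4 : (N ^ 2 <= 4 * num_paths2 H)%N.
    exact: sqr_le_double.
  have : (N ^ 2)%:R <= (4 * num_paths2 H)%:R :> R by rewrite ler_nat.
  rewrite natrX natrM => hP5.
  have y2N : y ^+ 2 <= N%:R ^+ 2 by rewrite lerXn2r ?nnegrE ?(ltW hN) ?(ltW y0).
  have -> : (p / 128) ^+ 2 * n.+1%:R `^ (2 - p - 2 * k) = y ^+ 2 / 4.
    have -> : 2 - p - 2 * k = (c - k) * 2%:R by rewrite /c; field.
    by rewrite powRrM powR_mulrn ?powR_ge0 // /y /la; field.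
  by rewrite ler_pdivrMr //; lra.
pose n2 := n./2; pose m := (n - n./2)%N.
have nE : n = (m + n2)%N by rewrite subnK // -divn2 leq_div.
rewrite /Pr [in leLHS]nE Ex_D.
have h2 : n.+1%:R / 4 <= n2%:R :> R by exact: quarter_le_half.
have hm : n.+1%:R / 2 <= m.+1%:R :> R by exact: half_le_uphalf.
have tc0 : 0 < n.+1%:R `^ c :> R by rewrite powR_gt0.
pose rho : R := 64 / p * n.+1%:R `^ (- (k / 2)).
have late H : wf_graph H -> size (edges H) = m.+1 ->
    Ex p n2 (fun H => (B H)%:R) H <= ((degree H 0)%:R <= la)%R%:R + rho.
  move=> wH hs; have rho0 : 0 <= rho by rewrite mulr_ge0 ?powR_ge0 // divr_ge0 // ltW.
  case: (leP (degree H 0)%:R la) => hd.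
    apply: (@le_trans _ _ 1); last by rewrite lerDl.
    rewrite -[leRHS](Ex_cst p01 n2 1 wH); apply: (Ex_le p01 n2 step_closed_wf) => // H' _.
    by case: (B H').
  rewrite add0r; apply: (@le_trans _ _ (Ex p n2 (fun H => expR y * 2^-1 ^+ size (spokes H)) H)).
    apply: (Ex_le p01 n2 step_closed_wf) => // H' _; rewrite /B.
    case: (leP (size (spokes H'))%:R y) => hN; first exact: half_pow_ge.
    by rewrite mulr_ge0 ?expR_ge0 // exprn_ge0 // invr_ge0.
  rewrite (ExZ p01).
  have := Ex_few_spokes p01 n2 wH (ltW la0) (ltW hd); rewrite hs addSn -nE => h.
  apply: (le_trans (ler_wpM2l (expR_ge0 _) h)); rewrite -expRD.
  have h16 : p * la / 16 <= p * la / (4 * n.+1%:R) * n2%:R.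
    have -> : p * la / 16 = p * la / (4 * n.+1%:R) * (n.+1%:R / 4).
      by field; rewrite gt_eqF.
    by rewrite ler_wpM2l // divr_ge0 // ?mulr_ge0 // ltW.
  apply: (@le_trans _ _ (expR (- y))).
    by rewrite ler_expR /y; move: h16; move: (p * la / _ * _) => z; lra.
  apply: (le_trans (expRN_le y0)).
  have -> : y^-1 = 64 / p * n.+1%:R `^ (- (c - k)).
    by rewrite /y /la powRN; field; rewrite !gt_eqF // powR_gt0.
  rewrite ler_wpM2l ?divr_ge0 ?(ltW p0) // ler_powR // lerN2.
  exact: ck2.
apply: (@le_trans _ _ (Ex p m (fun H => ((degree H 0)%:R <= la)%R%:R + rho) loop_graph)).
  apply: (Ex_le_size p01 step_closed_wf); first exact: wf_loop_graph.
  by move=> H wH; rewrite /= add1n => hs; exact: late.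
rewrite (ExD p01) (Ex_cst p01) ?[X in _ <= X]mulrDl; last exact: wf_loop_graph.
rewrite lerD2r.
apply: (le_trans (Ex_light p01 m la0 wf_loop_graph (ltn0Sn 0))); rewrite -/C.
rewrite ler_wpM2l ?(ltW C0) // -/c -mulNr powRrM.
rewrite ge0_ler_powR ?nnegrE ?invr_ge0 ?powR_ge0 // ?mulr_ge0 ?powR_ge0 ?(ltW la0) //.
rewrite /= add1n -/c div1r.
have -> : n.+1%:R `^ (- k) = la * (2 / n.+1%:R `^ c) :> R.
  have -> : n.+1%:R `^ (- k) = n.+1%:R `^ (c - k) * n.+1%:R `^ (- c) :> R.
    by rewrite -tD; congr (_ `^ _); ring.
  by rewrite /la powRN; field; rewrite gt_eqF.
rewrite ler_wpM2l ?(ltW la0) //.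
apply: (@le_trans _ _ ((2 / n.+1%:R) `^ c)).
  rewrite ge0_ler_powR ?nnegrE ?invr_ge0 ?divr_ge0 ?(ltW c0) //.
  by rewrite -[2 / _]invf_div lef_pV2 ?posrE ?divr_gt0.
rewrite powRM ?invr_ge0 // -(powR_inv1 (ltW n0)) -powRrM mulN1r powRN.
rewrite ler_wpM2r ?invr_ge0 ?powR_ge0 //.
by rewrite -[leRHS]powRr1 // ler_powR // ler1n.
Unshelve. all: by end_near. Qed.

End LowerBounds.

(** * Many triangles *)

Section Spread.
Variables (H : mgraph) (l : nat).
Hypothesis wH : wf_graph H.

Let T := ('I_l * 'I_l * 'I_l)%type.
Let v1 (a : T) : nat := a.1.1.
Let v2 (a : T) : nat := (l + a.1.2)%N.
Let v3 (a : T) : nat := (l + l + a.2)%N.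

Let v_lt a : (v1 a < v2 a)%N && (v2 a < v3 a)%N && (v1 a < l)%N.
Proof.
case: a => [[[a ha] [b hb]] [d hd]]; rewrite /v1 /v2 /v3 /=; lia.
Qed.

Let spread_inj a b : v1 a \in [:: v1 b; v2 b; v3 b] ->
  v2 a \in [:: v1 b; v2 b; v3 b] -> v3 a \in [:: v1 b; v2 b; v3 b] -> a = b.
Proof.
case: a => [[[a ha] [b' hb]] [d hd]]; case: b => [[[x hx] [y hy]] [z hz]].
rewrite /v1 /v2 /v3 /= !inE => h1 h2 h3.
have [ax [by_ dz]] : a = x /\ b' = y /\ d = z by lia.
by subst x y z; rewrite (bool_irrelevance ha hx) (bool_irrelevance hb hy) (bool_irrelevance hd hz).
Qed.

(** Taking the three members in consecutive blocks of [l] vertices makes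
    different triples different sets of vertices. *)
Lemma spread_triangles_le :
  (\sum_(a : 'I_l * 'I_l * 'I_l)
     triangle_at a.1.1 (l + a.1.2) (l + l + a.2) H <= num_triangles H)%N.
Proof.
pose A : {set T} := [set a : T | triangle_at (v1 a) (v2 a) (v3 a) H]%SET.
have -> : (\sum_(a : 'I_l * 'I_l * 'I_l)
     triangle_at a.1.1 (l + a.1.2) (l + l + a.2) H)%N = #|A|.
  rewrite -sum1_card [RHS]big_mkcond; apply: eq_bigr => a _.
  by rewrite inE /v1 /v2 /v3; case: triangle_at.
pose f (a : T) : {set 'I_(nvert H)} :=
  [set x : 'I_(nvert H) | (x : nat) \in [:: v1 a; v2 a; v3 a]]%SET.
have inA a : a \in A -> [/\ (v1 a < nvert H)%N, (v2 a < nvert H)%N, (v3 a < nvert H)%N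
    & triangle_at (v1 a) (v2 a) (v3 a) H].
  rewrite inE => ta; have /and3P[a1 a2 a3] := ta.
  by have /andP[? ?] := adj_wf wH a1; have /andP[? ?] := adj_wf wH a3.
have finj : {in A &, injective f}.
  move=> a b aA bA fab; have [h1 h2 h3 _] := inA _ aA.
  have e (x : 'I_(nvert H)) : x \in f a -> (x : nat) \in [:: v1 b; v2 b; v3 b].
    by rewrite fab inE.
  apply: spread_inj.
  - by apply: (e (Ordinal h1)); rewrite !inE /= eqxx.
  - by apply: (e (Ordinal h2)); rewrite !inE /= eqxx orbT.
  - by apply: (e (Ordinal h3)); rewrite !inE /= eqxx !orbT.
rewrite -(card_in_imset finj); apply/subset_leq_card/fintype.subsetP => _ /imsetP[a aA ->].
have [h1 h2 h3 /and3P[a1 a2 a3]] := inA _ aA.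
have /andP[/andP[l1 l2] _] := v_lt a.
have fE : f a = [set Ordinal h1; Ordinal h2; Ordinal h3]%SET.
  by apply/setP => x; rewrite !inE -!val_eqE /= orbA.
rewrite inE fE; apply/andP; split.
  rewrite -finset.setUA cardsU1 cards2 !inE -!val_eqE /=.
  by rewrite (ltn_eqF l1) (ltn_eqF l2) (ltn_eqF (ltn_trans l1 l2)).
have sym x y : adj H x y = adj H y x by rewrite /adj orbC.
apply/forallP => x; apply/implyP => xS; apply/forallP => y; apply/implyP => yS.
apply/implyP => xy; move: xS yS xy; rewrite !inE.
by move=> /orP[/orP[]|] /eqP -> /orP[/orP[]|] /eqP ->; rewrite ?eqxx //= 1?sym ?a1 ?a2 ?a3 // sym.
Qed.

End Spread.

Section ManyTriangles.
Variables (R : realType) (p : R).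
Hypothesis p01 : 0 < p < 1.

Let p0 : 0 < p. Proof. by case/andP: p01. Qed.
Let p1 : p < 1. Proof. by case/andP: p01. Qed.
Let q0 : 0 < 1 - p. Proof. by rewrite subr_gt0. Qed.
Let c : R := 1 - p / 2.
Let c0 : 0 < c. Proof. by rewrite /c; have := p1; lra. Qed.
Let c1 : c <= 1. Proof. by rewrite /c; have := p0; lra. Qed.
Let a : R := clique_exp p.
Let a0 : 0 < a.
Proof. by rewrite divr_gt0 //; have := p1; lra. Qed.
Let a2 : a <= 2^-1.
Proof. by rewrite /a /clique_exp ler_pdivrMr; have := p1; have := p0; lra. Qed.

Lemma half_split n : n = (n./2 + (n - n./2))%N.
Proof. by rewrite subnKC // -divn2 leq_div. Qed.

(** Two of the first [m] vertices stay apart only if at most [m] vertices are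
    born by the early time [n1], or one of the two is still light at half time,
    or the remaining edge-steps fail to join two vertices of large degree. *)
Lemma Ex_nonadj_early n1 n2 n3 m i j (la : R) : (i < m)%N -> (j < m)%N -> 0 < la ->
  Ex p (n1 + (n2 + n3)) (fun H => (~~ adj H i j)%:R) loop_graph <=
  expR (m%:R - p / 2 * n1%:R) +
  (2 * (2 * expR (rate p (- 2^-1)) *
     (la * (n1.+1%:R / (n1 + n2).+1%:R) `^ c) `^ 2^-1) +
   expR (- ((1 - p) * (la / (2 * (n1 + n2 + n3).+1%:R)) ^+ 2 * n3%:R))).
Proof.
move=> im jm la0; set V := 2 * expR _ * _; set rho := expR (- _).
have V0 : 0 <= V by rewrite !mulr_ge0 ?expR_ge0 ?powR_ge0.
have rho0 : 0 <= rho by exact: expR_ge0.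
have late H : wf_graph H -> (i < nvert H)%N -> (j < nvert H)%N ->
    size (edges H) = (n1 + n2).+1 ->
    Ex p n3 (fun H => (~~ adj H i j)%:R) H <=
    ((degree H i)%:R <= la)%R%:R + (((degree H j)%:R <= la)%R%:R + rho).
  move=> wH iH jH hs.
  have le1 : Ex p n3 (fun H => (~~ adj H i j)%:R) H <= 1.
    rewrite -[leRHS](Ex_cst p01 n3 1 wH); apply: (Ex_le p01 n3 step_closed_wf) => // H' _.
    by case: adj.
  case: (leP (degree H i)%:R la) => hi.
    by apply: (le_trans le1); rewrite lerDl addr_ge0.
  case: (leP (degree H j)%:R la) => hj.
    by apply: (le_trans le1); rewrite add0r lerDl.
  rewrite !add0r; have := Ex_nonadj p01 n3 wH (ltW la0) (ltW hi) (ltW hj) iH jH.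
  by rewrite hs addSn.
have mid H : wf_graph H -> size (edges H) = n1.+1 ->
    Ex p (n2 + n3) (fun H => (~~ adj H i j)%:R) H <=
    (nvert H <= m)%N%:R + (2 * V + rho).
  move=> wH hs; case: (leqP (nvert H) m) => hm.
    apply: (@le_trans _ _ 1); last by rewrite lerDl addr_ge0 // mulr_ge0.
    rewrite -[leRHS](Ex_cst p01 (n2 + n3) 1 wH).
    by apply: (Ex_le p01 _ step_closed_wf) => // H' _; case: adj.
  have iH := ltn_trans im hm; have jH := ltn_trans jm hm.
  rewrite add0r Ex_D.
  apply: (@le_trans _ _ (Ex p n2 (fun H => ((degree H i)%:R <= la)%R%:R +
      (((degree H j)%:R <= la)%R%:R + rho)) H)).
    apply: (Ex_le_size p01 (S := fun H' => wf_graph H' /\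
       ((i < nvert H')%N /\ (j < nvert H')%N))) => //.
      apply: step_closedI; first exact: step_closed_wf.
      by apply: step_closedI => H' iH'; split=> //= u _; exact: ltnW.
    by move=> H' [wH' [iH' jH']]; rewrite hs addSn => hs'; exact: late.
  rewrite 2!(ExD p01) (Ex_cst p01) //.
  have := Ex_light p01 n2 la0 wH iH; have := Ex_light p01 n2 la0 wH jH.
  rewrite hs addSn -/c -/V => hi hj.
  by rewrite addrA lerD2r; move: (Ex _ _ _ _) (Ex _ _ _ _) hi hj => x y; lra.
rewrite Ex_D.
apply: (@le_trans _ _ (Ex p n1 (fun H => expR m%:R * 2^-1 ^+ nvert H +
    (2 * V + rho)) loop_graph)).
  apply: (Ex_le_size p01 step_closed_wf); first exact: wf_loop_graph.
  move=> H wH; rewrite /= add1n => hs; apply: (le_trans (mid H wH hs)).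
  rewrite lerD2r; case: (leqP (nvert H) m) => hm.
    by apply: half_pow_ge; rewrite ler_nat.
  by rewrite mulr_ge0 ?expR_ge0 // exprn_ge0 // invr_ge0.
rewrite (ExD p01) (Ex_cst p01); last exact: wf_loop_graph.
rewrite lerD2r (ExZ p01) expRD ler_wpM2l ?expR_ge0 //.
exact: Ex_few_vertices.
Qed.

(** At half time a vertex born before [n `^ (a - k)] typically has degree
    [n `^ (c (1 - a + k))]. As [2 c (1 - a) = 1], two such vertices are expected
    to be joined by about [n `^ (2 c k)] edge-steps afterwards. *)
Lemma early_adjacent (k : R) : 0 < k -> k <= a / 2 -> exists2 C : R, 0 < C &
  \forall n \near \oo, forall i j m, (i < m)%N -> (j < m)%N ->
  m%:R <= p / 4 * n.+1%:R `^ (a - k) ->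
  Ex p n (fun H => (~~ adj H i j)%:R) loop_graph <= C * n.+1%:R `^ (- (c * k / 4)).
Proof.
move=> k0 ka; pose K := expR (rate p (- 2^-1)).
have K0 : 0 < K by exact: expR_gt0.
pose eta := c * k / 4.
have eta0 : 0 < eta by rewrite divr_gt0 // mulr_gt0.
have ak0 : 0 < a - k by move: k0 ka a0; lra.
have h2 : 0 < (2^-1 : R) by [].
exists (expR 1 * (4 / p) + (2 * (2 * K * 8) + 16 / (1 - p))).
  by rewrite !addr_gt0 ?mulr_gt0 ?invr_gt0 ?expR_gt0.
near=> n => i j m im jm hm.
have n3 : (3 <= n)%N by near: n; exact: nbhs_infty_ge.
have hX1 : 1 <= n.+1%:R `^ (a - k) by near: n; exact: powR_near_ge.
have h4 : 4 <= n.+1%:R `^ 2^-1 :> R by near: n; exact: powR_near_ge.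
have n0 : 0 < n.+1%:R :> R by [].
have nn1 : 1 <= n.+1%:R :> R by rewrite ler1n.
have tD x y : n.+1%:R `^ (x + y) = n.+1%:R `^ x * n.+1%:R `^ y :> R.
  by rewrite powRD // (gt_eqF n0) implybT.
set X := n.+1%:R `^ (a - k) in hX1 hm *.
have X0 : 0 < X by exact: lt_le_trans hX1.
pose n1 := Num.truncn X.
have n1X : n1%:R <= X by rewrite truncn_le // ltW.
have Xn1 : X <= n1.+1%:R by rewrite ltW // truncnS_gt.
have hX4 : X <= n.+1%:R / 4.
  apply: (@le_trans _ _ (n.+1%:R `^ 2^-1)).
    by rewrite ler_powR //; move: a2 k0; lra.
  rewrite ler_pdivlMr //; apply: (@le_trans _ _ (n.+1%:R `^ 2^-1 * n.+1%:R `^ 2^-1)).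
    by rewrite ler_wpM2l ?powR_ge0.
  rewrite -tD (_ : 2^-1 + 2^-1 = 1); last by field.
  by rewrite powRr1.
have hh := quarter_le_half R n3.
have n1h : (n1 <= n./2)%N.
  by rewrite -(ler_nat R) (le_trans n1X) // (le_trans hX4).
pose n2 := (n./2 - n1)%N; pose n3' := (n - n./2)%N.
have n12 : (n1 + n2)%N = n./2 by rewrite subnKC.
have nE : n = (n1 + (n2 + n3'))%N by rewrite addnA n12 -half_split.
have hn3 : n.+1%:R / 4 <= n3'%:R :> R.
  rewrite (le_trans hh) // ler_nat leq_subRL -?divn2 ?leq_div // divn2 addnn.
  by rewrite -[leqRHS]odd_double_half leq_addl.
(* the typical degree, lowered by the factor n to the power c k / 2 *)
pose la : R := n.+1%:R `^ (c * (1 - a) + c * k / 2).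
have la0 : 0 < la by rewrite powR_gt0.
rewrite [X in Ex p X]nE; apply: (le_trans (Ex_nonadj_early n1 n2 n3' im jm la0)).
have -> : (n1 + n2 + n3').+1 = n.+1 by rewrite -addnA -nE.
rewrite n12 -/K.
have etaX : X^-1 <= n.+1%:R `^ (- eta).
  rewrite -powRN ler_powR // lerN2 /eta.
  have : c * k <= 1 * k by rewrite ler_wpM2r // ltW.
  by move: k0 ka; move: (c * k) => z; lra.
rewrite [leRHS]mulrDl [X in _ <= _ + X]mulrDl; apply: lerD; [|apply: lerD].
- apply: (@le_trans _ _ (expR (1 - p / 4 * X))).
    rewrite ler_expR.
    have : p / 2 * X <= p / 2 * n1.+1%:R by rewrite ler_wpM2l // divr_ge0 // ltW.
    rewrite -[n1.+1]addn1 natrD mulrDr mulr1; move: hm p1.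
    by move: (m%:R) (p / 2 * n1%:R) => y z; lra.
  rewrite expRD -[leRHS]mulrA ler_wpM2l ?expR_ge0 //.
  have pX0 : 0 < p / 4 * X by rewrite mulr_gt0 // divr_gt0.
  apply: (le_trans (expRN_le pX0)); rewrite invfM invf_div ler_wpM2l //.
  by rewrite divr_ge0 // ltW.
- rewrite -!mulrA ler_wpM2l // ler_wpM2l // ler_wpM2l ?(ltW K0) //.
  have hq : (n1.+1%:R / n./2.+1%:R) `^ c <= 8 * n.+1%:R `^ (c * (a - k - 1)).
    apply: (@le_trans _ _ ((8 * n.+1%:R `^ (a - k - 1)) `^ c)).
      rewrite ge0_ler_powR ?nnegrE ?(ltW c0) ?divr_ge0 ?mulr_ge0 ?powR_ge0 //.
      rewrite ler_pdivrMr //.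
      have hX2 : n1.+1%:R <= 2 * X.
        by rewrite -[n1.+1]addn1 natrD; move: n1X hX1; move: (n1%:R) => z; lra.
      apply: (le_trans hX2).
      have -> : 2 * X = 8 * n.+1%:R `^ (a - k - 1) * (n.+1%:R / 4).
        by have := tD (a - k - 1) 1; rewrite subrK (powRr1 (ltW n0)) -/X => ->; field.
      rewrite ler_wpM2l ?mulr_ge0 ?powR_ge0 // (le_trans hh) // ler_nat.
      exact: leqnSn.
    rewrite powRM ?powR_ge0 // -powRrM (mulrC (a - k - 1)) ler_wpM2r ?powR_ge0 //.
    by rewrite -[leRHS]powRr1 // ler_powR // ler1n.
  apply: (@le_trans _ _ ((8 * n.+1%:R `^ (- (c * k / 2))) `^ 2^-1)).
    rewrite ge0_ler_powR ?nnegrE ?mulr_ge0 ?powR_ge0 //.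
    apply: (le_trans (ler_wpM2l (ltW la0) hq)); rewrite mulrCA -tD.
    rewrite le_eqVlt; apply/orP; left; apply/eqP; congr (8 * _ `^ _); by field.
  rewrite powRM ?powR_ge0 // -powRrM ler_pM ?powR_ge0 //.
    by rewrite -[leRHS]powRr1 // ler_powR ?ler1n // invf_le1 // ler1n.
  by rewrite le_eqVlt; apply/orP; left; apply/eqP; congr (_ `^ _); rewrite /eta; field.
- have hrho : (1 - p) / 16 * n.+1%:R `^ (c * k) <=
      (1 - p) * (la / (2 * n.+1%:R)) ^+ 2 * n3'%:R.
    apply: (@le_trans _ _ ((1 - p) * (la / (2 * n.+1%:R)) ^+ 2 * (n.+1%:R / 4))).
      have -> : n.+1%:R `^ (c * k) = la ^+ 2 / n.+1%:R.
        rewrite -powR_mulrn ?powR_ge0 // -powRrM -[X in _ / X](powRr1 (ltW n0)) -powRN -tD.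
        congr (_ `^ _); rewrite /c /a /clique_exp; field.
        by have := p1; lra.
      by rewrite le_eqVlt; apply/orP; left; apply/eqP; field; rewrite gt_eqF.
    by rewrite ler_wpM2l // mulr_ge0 ?exprn_ge0 ?divr_ge0 ?(ltW la0) ?(ltW q0).
  have r0 : 0 < (1 - p) / 16 * n.+1%:R `^ (c * k) by rewrite mulr_gt0 ?divr_gt0 ?powR_gt0.
  apply: (@le_trans _ _ (expR (- ((1 - p) / 16 * n.+1%:R `^ (c * k))))).
    by rewrite ler_expR lerN2.
  apply: (le_trans (expRN_le r0)); rewrite invfM invf_div -powRN.
  rewrite ler_wpM2l ?divr_ge0 ?(ltW q0) // ler_powR // lerN2.
  have : 0 <= c * k by rewrite mulr_ge0 // ltW.
  by rewrite /eta; move: (c * k) => z; lra.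
Unshelve. all: by end_near. Qed.

(** Most pairs among the first [n `^ (a - k)] vertices are joined,
    hence so are most triples. *)
Lemma many_triangles (k : R) : 0 < k -> k <= a / 2 -> exists2 K, 0 < K &
  Pr p n (fun H => (num_triangles H)%:R < K * n.+1%:R `^ (3 * (a - k)))
    @[n --> \oo] --> (0 : R).
Proof.
move=> k0 ka; have [C C0 hC] := early_adjacent k0 ka.
have ak0 : 0 < a - k by move: k0 ka a0; lra.
have eta0 : 0 < c * k / 4 by rewrite divr_gt0 // mulr_gt0.
exists ((p / 24) ^+ 3 / 2); first by rewrite divr_gt0 // exprn_gt0 // divr_gt0.
apply: (@unlikely_powR _ _ p01 _ (6 * C) _ eta0); near=> n.
have hn : forall i j m, (i < m)%N -> (j < m)%N ->
  m%:R <= p / 4 * n.+1%:R `^ (a - k) ->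
  Ex p n (fun H => (~~ adj H i j)%:R) loop_graph <= C * n.+1%:R `^ (- (c * k / 4)).
  by near: n.
have hX : 24 / p <= n.+1%:R `^ (a - k) by near: n; exact: powR_near_ge.
set X := n.+1%:R `^ (a - k) in hn hX *.
set e := C * _ in hn.
have X0 : 0 < X by rewrite powR_gt0.
have e0 : 0 <= e by rewrite mulr_ge0 ?powR_ge0 // ltW.
pose l := Num.truncn (p / 12 * X).
have pX0 : 0 <= p / 12 * X by rewrite mulr_ge0 ?divr_ge0 ?ltW.
have lX : l%:R <= p / 12 * X by rewrite truncn_le.
have Xl : p / 24 * X <= l%:R.
  have : p / 12 * X <= l.+1%:R by rewrite ltW // truncnS_gt.
  have : 24 <= X * p by rewrite -ler_pdivrMr.
  by rewrite -[l.+1]addn1 natrD; move: (l%:R) => z; lra.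
have l0 : 0 < l%:R :> R by rewrite (lt_le_trans _ Xl) // mulr_gt0 // divr_gt0.
have hm : (l + l + l)%:R <= p / 4 * X by rewrite !natrD; move: lX; move: (l%:R) => z; lra.
pose Y (H : mgraph) : R := \sum_(b : 'I_l * 'I_l * 'I_l)
   (~~ triangle_at b.1.1 (l + b.1.2) (l + l + b.2) H)%:R.
apply: le_trans (Pr_markov p01 (F := Y) (K := l%:R ^+ 3 / 2) _ _ _) _.
- by rewrite divr_gt0 // exprn_gt0.
- by move=> H _; rewrite sumr_ge0.
- move=> H wH _ hT.
  have hT2 : (num_triangles H)%:R <= l%:R ^+ 3 / 2 :> R.
    rewrite (le_trans (ltW hT)) // mulrC (mulrC 3) powRrM powR_mulrn ?powR_ge0 // -/X.
    rewrite mulrA (mulrC (X ^+ 3)) -exprMn ler_wpM2r ?invr_ge0 //.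
    by rewrite lerXn2r ?nnegrE ?(ltW l0) // mulr_ge0 ?divr_ge0 ?(ltW X0) ?(ltW p0).
  have hsum : l%:R ^+ 3 = Y H + (\sum_(b : 'I_l * 'I_l * 'I_l)
     triangle_at b.1.1 (l + b.1.2) (l + l + b.2) H)%:R :> R.
    rewrite natr_sum /Y -big_split /= (eq_bigr (fun=> 1)).
      by rewrite sumr_const !card_prod !card_ord !natrM !exprS expr0 mulr1 mulrA.
    by move=> b _; case: triangle_at; rewrite ?add0r ?addr0.
  have := spread_triangles_le l wH; rewrite -(ler_nat R).
  move: hsum hT2; move: (\sum_(_ | _) _)%:R ((num_triangles H)%:R) (l%:R ^+ 3) => x y z.
  lra.
rewrite ler_pdivrMr ?divr_gt0 ?exprn_gt0 // (Ex_sum p01); last exact: wf_loop_graph.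
apply: (@le_trans _ _ (\sum_(b : 'I_l * 'I_l * 'I_l) 3 * e)).
  apply: ler_sum => b _.
  set i := (b.1.1 : nat); set j := (l + b.1.2)%N; set d := (l + l + b.2)%N.
  have il : (i < l + l + l)%N by rewrite -addnA (leq_trans (ltn_ord _)) // leq_addr.
  have jl : (j < l + l + l)%N by rewrite /j (leq_trans _ (leq_addr _ _)) // ltn_add2l.
  have dl : (d < l + l + l)%N by rewrite /d ltn_add2l.
  apply: (@le_trans _ _ (Ex p n (fun H => (~~ adj H i j)%:R + ((~~ adj H i d)%:R +
     (~~ adj H j d)%:R)) loop_graph)).
    apply: (Ex_le p01 n step_closed_wf) => //; last exact: wf_loop_graph.
    move=> H _; rewrite /triangle_at -/i -/j -/d.
    case: (adj H i j); case: (adj H i d); case: (adj H j d) => //=; lra.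
  rewrite 2!(ExD p01); have h1 := hn _ _ _ il jl hm; have h2 := hn _ _ _ il dl hm.
  have h3 := hn _ _ _ jl dl hm; move: h1 h2 h3.
  move: (Ex _ _ _ _) (Ex _ _ _ _) (Ex _ _ _ _) => x y z; lra.
rewrite sumr_const !card_prod !card_ord -[leLHS]mulr_natl !natrM.
rewrite le_eqVlt; apply/orP; left; apply/eqP; rewrite /e; by field.
Unshelve. all: by end_near. Qed.

End ManyTriangles.

(** * The clustering coefficient *)

Section Clustering.
Variables (R : realType) (p : R).
Hypothesis p01 : 0 < p < 1.

Let p0 : 0 < p. Proof. by case/andP: p01. Qed.
Let p1 : p < 1. Proof. by case/andP: p01. Qed.

Lemma clustering_bounds (s1 s2 s3 s4 : R) (H : mgraph) :
  0 < s2 -> 0 < s4 ->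
  s1 <= (num_triangles H)%:R -> (num_paths2 H)%:R <= s2 ->
  (num_triangles H)%:R <= s3 -> s4 <= (num_paths2 H)%:R -> 0 <= s1 ->
  3 * (s1 / s2) <= clustering H <= 3 * (s3 / s4).
Proof.
move=> s20 s40 h1 h2 h3 h4 s10; rewrite /clustering.
have P0 : 0 < (num_paths2 H)%:R :> R by exact: lt_le_trans h4.
apply/andP; split; rewrite ler_wpM2l // ler_pM ?invr_ge0 // ?(ltW P0) ?(ltW s20) ?(ltW s40) //.
  by rewrite lef_pV2 ?posrE.
by rewrite lef_pV2 ?posrE.
Qed.

Lemma clustering_likely (eps : R) : 0 < eps ->
  exists C1 C2 : R, [/\ 0 < C1, 0 < C2 & exists bad : nat -> R,
    bad n @[n --> \oo] --> (0 : R) /\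
    forall n, 1 - bad n <= Pr p n (fun H =>
       C1 / (n.+1%:R `^ (gamma p * (1 + eps))) <= clustering H
          <= C2 / (n.+1%:R `^ (gamma p * (1 - eps))))].
Proof.
move=> e0; pose a := clique_exp p.
have a0 : 0 < a by rewrite divr_gt0 //; have := p1; lra.
have g0 : 0 < gamma p by apply: gamma_gt0; rewrite (ltW p0) (ltW p1).
have ge : gamma p = 2 - p - 3 * a by rewrite /gamma /a /clique_exp mulrA.
(* the errors in the exponents add up to at most 15 k *)
pose k := Num.min (eps * gamma p / 15) (Num.min 4^-1 (a / 2)).
have k0 : 0 < k.
  rewrite /k !lt_min; apply/and3P; split=> //; last by rewrite divr_gt0.
  by rewrite divr_gt0 // mulr_gt0.
have k15 : k <= eps * gamma p / 15 by rewrite /k ge_min lexx.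
have k4 : k <= 4^-1 by rewrite /k !ge_min lexx orbT.
have ka : k <= a / 2 by rewrite /k !ge_min lexx !orbT.
have [K1 K10 b1] := many_triangles p01 k0 ka.
have [K2 K20 b2] := few_paths2 p01 k0.
have [K3 K30 b3] := few_triangles p01 k0.
have [K4 K40 b4] := many_paths2 p01 k0 k4.
exists (3 * (K1 / K2)), (3 * (K3 / K4)); split; rewrite ?mulr_gt0 ?invr_gt0 //.
pose bad1 n (H : mgraph) := (num_triangles H)%:R < K1 * n.+1%:R `^ (3 * (a - k)).
pose bad2 n (H : mgraph) := K2 * n.+1%:R `^ (2 - p + 3 * k) < (num_paths2 H)%:R.
pose bad3 n (H : mgraph) := K3 * n.+1%:R `^ (3 * a + 13 * k) < (num_triangles H)%:R.
pose bad4 n (H : mgraph) := (num_paths2 H)%:R < K4 * n.+1%:R `^ (2 - p - 2 * k).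
exists (fun n => Pr p n (bad1 n) + (Pr p n (bad2 n) + (Pr p n (bad3 n) + Pr p n (bad4 n)))).
split.
  by rewrite -[X in _ --> X]addr0; apply: cvgD => //; rewrite -[X in _ --> X]addr0;
     apply: cvgD => //; rewrite -[X in _ --> X]addr0; apply: cvgD.
move=> n; rewrite lerBlDr /Pr -!(ExD p01) -[leLHS](Ex_cst p01 n 1 wf_loop_graph).
apply: (Ex_le p01 n step_closed_wf) => //; last exact: wf_loop_graph.
move=> H wH.
set A := (X in (nat_of_bool X)%:R + _); case: (boolP A) => [_|nA]; first by rewrite lerDl !addr_ge0.
rewrite add0r.
suff : [|| bad1 n H, bad2 n H, bad3 n H | bad4 n H].
  by case: (bad1 n H); case: (bad2 n H); case: (bad3 n H); case: (bad4 n H) => //=; lra.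
apply: contraNT nA; rewrite !negb_or -!leNgt => /and4P[h1 h2 h3 h4].
have n0 : 0 < n.+1%:R :> R by [].
have n1 : 1 <= n.+1%:R :> R by rewrite ler1n.
have t0 x : 0 < n.+1%:R `^ x :> R by rewrite powR_gt0.
have tD x y : n.+1%:R `^ (x + y) = n.+1%:R `^ x * n.+1%:R `^ y :> R.
  by rewrite powRD // (gt_eqF n0) implybT.
have /andP[lo hi] := clustering_bounds (mulr_gt0 K20 (t0 _)) (mulr_gt0 K40 (t0 _)) h1 h2 h3 h4
  (ltW (mulr_gt0 K10 (t0 _))).
have e15 : 15 * k <= eps * gamma p by move: k15; lra.
apply/andP; split.
  apply: le_trans lo; rewrite -mulrA ler_wpM2l // invfM mulrACA.
  rewrite ler_wpM2l ?divr_ge0 ?(ltW K10) ?(ltW K20) // -!powRN -tD ler_powR //.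
  by rewrite ge; move: e15; rewrite ge; lra.
apply: (le_trans hi); rewrite -[leRHS]mulrA ler_wpM2l // invfM mulrACA.
rewrite ler_wpM2l ?divr_ge0 ?(ltW K30) ?(ltW K40) // -!powRN -tD ler_powR //.
by rewrite ge; move: e15; rewrite ge; lra.
Qed.

End Clustering.

Theorem theorem1 (R : realType) (p eps : R) :
  0 < p < 1 -> 0 < eps < 1 ->
  exists C1 C2 : R, [/\ 0 < C1, 0 < C2 &
    forall (d : measure_display) (T : measurableType d) (P : probability T R)
      (Z : nat -> T -> bool) (G : nat -> T -> mgraph),
    pa_process P p Z G ->
    P [set x | C1 / (t%:R `^ (gamma p * (1 + eps))) <= clustering (G t x)
                 <= C2 / (t%:R `^ (gamma p * (1 - eps)))]
      @[t --> \oo] --> 1%E].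
Proof.
move=> p01 /andP[e0 _].
have [C1 [C2 [C10 C20 [bad [bad0 hbad]]]]] := clustering_likely p01 e0.
exists C1, C2; split=> // d T P Z G hG.
rewrite -cvg_shiftS /=.
apply: (@squeeze_cvge _ _ _ _ (fun n => (1 - bad n)%:E) _ (fun=> 1%E) _ 1%E).
- near=> n; apply/andP; split.
    have h := Ex_le_prob hG p01 (fun H : mgraph =>
       C1 / (n.+1%:R `^ (gamma p * (1 + eps))) <= clustering H
          <= C2 / (n.+1%:R `^ (gamma p * (1 - eps)))) n.
    by apply: le_trans h; rewrite lee_fin; exact: hbad.
  apply: probability_le1.
  exact: (measurable_graph_pred hG (fun H : mgraph =>
       C1 / (n.+1%:R `^ (gamma p * (1 + eps))) <= clustering H
          <= C2 / (n.+1%:R `^ (gamma p * (1 - eps)))) (ltn0Sn n)).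
- apply: cvg_EFin; first exact: nearW.
  by rewrite -[X in _ --> X]subr0; apply: cvgB => //; exact: cvg_cst.
- exact: cvg_cst.
Unshelve. all: by end_near. Qed.
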